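(* There exists an $\omega$-model satisfying $\mathsf{RCA}_0+\mathsf{RT}^2_2$ but not $\Sigma^0_2$-$\mathsf{Subset}$.
   Context: $\mathsf{RT}^2_2$: for every infinite $X\subseteq\mathbb{N}$ and every $c:[X]^2\to 2$ there is an infinite $H\subseteq X$ with $c\restriction[H]^2$ constant. $\Sigma^0_2$-$\mathsf{Subset}$ is the scheme asserting, for each $\Sigma^0_2$ formula $\varphi(x)$ of second-order arithmetic (with parameters), that there is an infinite set $Y$ with either $(\forall x)[x\in Y\to\varphi(x)]$ or $(\forall x)[x\in Y\to\neg\varphi(x)]$. *)

(* Defs.v *)
From mathcomp Require Import all_boot.
From mathcomp Require Import boolp classical_sets.

Set Implicit Arguments.
Unset Strict Implicit.
Unset Printing Implicit Defensive.

Local Open Scope classical_set_scope.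

(* Formulas of second-order arithmetic use de Bruijn indices, with
   independent index spaces for number variables and for set variables: a
   number quantifier binds number index 0 and leaves set indices alone, and
   vice versa. *)

Inductive term : Type :=
| Var of nat
| Zero
| One
| Plus of term & term
| Times of term & term.

Inductive formula : Type :=
| Eq of term & term
| Lt of term & term
| Mem of term & nat
| Not of formula
| And of formula & formula
| Or of formula & formula
| Imp of formula & formula
| AllN of formula
| ExN of formula
| AllS of formula
| ExS of formula.

Declare Scope so_scope.
Delimit Scope so_scope with SO.
Bind Scope so_scope with term formula.

Notation "# i" := (Var i) (at level 2, i at level 1, format "# i") : so_scope.
Notation "0" := Zero : so_scope.
Notation "1" := One : so_scope.
Notation "s + t" := (Plus s t) : so_scope.
Notation "s * t" := (Times s t) : so_scope.
Notation "s === t" := (Eq s t) (at level 70, no associativity) : so_scope.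
Notation "s < t" := (Lt s t) : so_scope.
Notation "t ∈ X" := (Mem t X%N) (at level 70, no associativity) : so_scope.
Notation "¬ p" := (Not p) (at level 75, right associativity) : so_scope.
Notation "p ∧ q" := (And p q) (at level 80, right associativity) : so_scope.
Notation "p ∨ q" := (Or p q) (at level 85, right associativity) : so_scope.
Notation "p ⇒ q" := (Imp p q) (at level 90, right associativity) : so_scope.
Notation "p ⇔ q" := (And (Imp p q) (Imp q p))
  (at level 95, no associativity) : so_scope.
Notation "'∀N' p" := (AllN p) (at level 10, p at level 200) : so_scope.
Notation "'∃N' p" := (ExN p) (at level 10, p at level 200) : so_scope.
Notation "'∀S' p" := (AllS p) (at level 10, p at level 200) : so_scope.
Notation "'∃S' p" := (ExS p) (at level 10, p at level 200) : so_scope.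

Definition scons (T : Type) (a : T) (e : nat -> T) : nat -> T :=
  fun i => if i is j.+1 then e j else a.

Fixpoint tsubst (s : nat -> term) (t : term) : term :=
  match t with
  | Var i => s i
  | Zero => Zero
  | One => One
  | Plus a b => Plus (tsubst s a) (tsubst s b)
  | Times a b => Times (tsubst s a) (tsubst s b)
  end.

Definition tshift : term -> term := tsubst (fun i => Var i.+1).

Definition up (s : nat -> term) : nat -> term :=
  scons (Var 0) (fun i => tshift (s i)).

Fixpoint subst (s : nat -> term) (p : formula) : formula :=
  match p with
  | Eq a b => Eq (tsubst s a) (tsubst s b)
  | Lt a b => Lt (tsubst s a) (tsubst s b)
  | Mem a X => Mem (tsubst s a) X
  | Not p => Not (subst s p)
  | And p q => And (subst s p) (subst s q)
  | Or p q => Or (subst s p) (subst s q)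
  | Imp p q => Imp (subst s p) (subst s q)
  | AllN p => AllN (subst (up s) p)
  | ExN p => ExN (subst (up s) p)
  | AllS p => AllS (subst s p)
  | ExS p => ExS (subst s p)
  end.

Definition up_ren (r : nat -> nat) : nat -> nat := scons 0 (fun i => (r i).+1).

Fixpoint renS (r : nat -> nat) (p : formula) : formula :=
  match p with
  | Eq a b => Eq a b
  | Lt a b => Lt a b
  | Mem a X => Mem a (r X)
  | Not p => Not (renS r p)
  | And p q => And (renS r p) (renS r q)
  | Or p q => Or (renS r p) (renS r q)
  | Imp p q => Imp (renS r p) (renS r q)
  | AllN p => AllN (renS r p)
  | ExN p => ExN (renS r p)
  | AllS p => AllS (renS (up_ren r) p)
  | ExS p => ExS (renS (up_ren r) p)
  end.

(* Placing [shiftS p] under a set quantifier expresses that the quantified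
   set variable is not free in [p]. *)
Definition shiftS : formula -> formula := renS succn.

(* The bounded quantifiers are (∀n<t) and (∃n<t), where n does not occur in t;
   n <= t is n < t + 1. *)
Inductive bounded : formula -> Prop :=
| bounded_Eq a b : bounded (Eq a b)
| bounded_Lt a b : bounded (Lt a b)
| bounded_Mem a X : bounded (Mem a X)
| bounded_Not p : bounded p -> bounded (Not p)
| bounded_And p q : bounded p -> bounded q -> bounded (And p q)
| bounded_Or p q : bounded p -> bounded q -> bounded (Or p q)
| bounded_Imp p q : bounded p -> bounded q -> bounded (Imp p q)
| bounded_All t p : bounded p -> bounded (∀N #0 < tshift t ⇒ p)%SO
| bounded_Ex t p : bounded p -> bounded (∃N #0 < tshift t ∧ p)%SO.

Inductive Sigma0 : nat -> formula -> Prop :=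
| Sigma0_0 p : bounded p -> Sigma0 0 p
| Sigma0_S k p : Pi0 k p -> Sigma0 k.+1 (ExN p)
with Pi0 : nat -> formula -> Prop :=
| Pi0_0 p : bounded p -> Pi0 0 p
| Pi0_S k p : Sigma0 k p -> Pi0 k.+1 (AllN p).

(* The first-order part of an omega-model is the standard one, so the model is
   given by the nonempty collection of sets of numbers over which the set
   variables range. *)
Record omega_model : Type := OmegaModel {
  sets_of : set (set nat);
  sets_of_neq0 : sets_of !=set0
}.

Fixpoint teval (e : nat -> nat) (t : term) : nat :=
  match t with
  | Var i => e i
  | Zero => 0
  | One => 1
  | Plus a b => teval e a + teval e b
  | Times a b => teval e a * teval e b
  end.

Fixpoint sat (M : omega_model) (e : nat -> nat) (E : nat -> set nat)
    (p : formula) : Prop :=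
  match p with
  | Eq a b => teval e a = teval e b
  | Lt a b => teval e a < teval e b
  | Mem a X => E X (teval e a)
  | Not p => ~ sat M e E p
  | And p q => sat M e E p /\ sat M e E q
  | Or p q => sat M e E p \/ sat M e E q
  | Imp p q => sat M e E p -> sat M e E q
  | AllN p => forall n : nat, sat M (scons n e) E p
  | ExN p => exists n : nat, sat M (scons n e) E p
  | AllS p => forall A : set nat, sets_of M A -> sat M e (scons A E) p
  | ExS p => exists A : set nat, sets_of M A /\ sat M e (scons A E) p
  end.

Definition theory := set formula.

(* Axioms may have free variables (parameters); as usual, they stand for their
   universal closures. *)
Definition models (M : omega_model) (T : theory) : Prop :=
  forall p : formula, T p ->
  forall (e : nat -> nat) (E : nat -> set nat), (forall i, sets_of M (E i)) ->
  sat M e E p.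

Inductive basic_axiom : theory :=
| ax_succ_neq0 : basic_axiom (¬ (#0 + 1 === 0))%SO
| ax_succ_inj : basic_axiom (#0 + 1 === #1 + 1 ⇒ #0 === #1)%SO
| ax_add0 : basic_axiom (#0 + 0 === #0)%SO
| ax_addS : basic_axiom (#0 + (#1 + 1) === (#0 + #1) + 1)%SO
| ax_mul0 : basic_axiom (#0 * 0 === 0)%SO
| ax_mulS : basic_axiom (#0 * (#1 + 1) === (#0 * #1) + #0)%SO
| ax_lt0 : basic_axiom (¬ (#0 < 0))%SO
| ax_ltS : basic_axiom (#0 < #1 + 1 ⇔ (#0 < #1 ∨ #0 === #1))%SO.

(* In a formula p(n), the distinguished variable n is number index 0; the
   remaining free variables are parameters. *)
Definition at_zero (p : formula) : formula := subst (scons 0%SO Var) p.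

Definition at_succ (p : formula) : formula :=
  subst (scons (#0 + 1)%SO (fun i => Var i.+1)) p.

Definition induction_axiom (p : formula) : formula :=
  (at_zero p ∧ (∀N p ⇒ at_succ p) ⇒ ∀N p)%SO.

Definition comprehension_axiom (p q : formula) : formula :=
  ((∀N p ⇔ q) ⇒ ∃S ∀N #0 ∈ 0 ⇔ shiftS p)%SO.

Inductive RCA0 : theory :=
| RCA0_basic p : basic_axiom p -> RCA0 p
| RCA0_induction p : Sigma0 1 p -> RCA0 (induction_axiom p)
| RCA0_comprehension p q :
    Sigma0 1 p -> Pi0 1 q -> RCA0 (comprehension_axiom p q).

Definition infinite_set_of (X : nat) : formula := (∀N ∃N #1 < #0 ∧ #0 ∈ X)%SO.

Definition subset_of (X Y : nat) : formula := (∀N #0 ∈ X ⇒ #0 ∈ Y)%SO.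

(* The injective pairing (i, j) = (i + j)^2 + i. *)
Definition pair_term (s t : term) : term := ((s + t) * (s + t) + s)%SO.

(* An element {x < y} of [X]^2 is coded as (x, y), and a function as the set of
   the codes of its argument-value pairs. *)
Definition entry (x y i : term) : term := pair_term (pair_term x y) i.

(* "C is a function from [X]^2 to 2 = {0, 1}" *)
Definition coloring_of (X C : nat) : formula :=
  ((∀N #0 ∈ C ⇒
      ∃N ∃N ∃N #2 ∈ X ∧ #1 ∈ X ∧ #2 < #1 ∧ #0 < 1 + 1 ∧ #3 === entry #2 #1 #0)
   ∧ (∀N ∀N #1 ∈ X ∧ #0 ∈ X ∧ #1 < #0 ⇒
        ∃N entry #2 #1 #0 ∈ C ∧ (∀N entry #3 #2 #0 ∈ C ⇒ #0 === #1)))%SO.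

(* "the coloring C is constant on [H]^2" *)
Definition homogeneous_for (C H : nat) : formula :=
  (∃N ∀N ∀N #1 ∈ H ∧ #0 ∈ H ∧ #1 < #0 ⇒ entry #1 #0 #2 ∈ C)%SO.

Definition RT22 : formula :=
  (∀S infinite_set_of 0 ⇒
   ∀S coloring_of 1 0 ⇒
   ∃S subset_of 0 2 ∧ infinite_set_of 0 ∧ homogeneous_for 1 0)%SO.

Definition subset_axiom (p : formula) : formula :=
  (∃S infinite_set_of 0 ∧
      ((∀N #0 ∈ 0 ⇒ shiftS p) ∨ (∀N #0 ∈ 0 ⇒ ¬ shiftS p)))%SO.

Definition Sigma02_Subset : theory :=
  [set subset_axiom p | p in Sigma0 2].

(* Main.v *)
Require Import Defs.
From mathcomp Require Import all_boot.
From mathcomp Require Import boolp classical_sets.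
From mathcomp Require Import zify.

(** Fix a set [S]. Call an oracle [Z] good if every total relation [Q(m, m')] holds for some
    [m, m'] such that the interval [[m, m']] is disjoint from [S] if [Q] is Sigma_1 in [Z], and
    such that [[m, m']] is contained in [S] if [Q] is Sigma_2 in [Z]. A good oracle computes
    no infinite subset of [S] or of its complement.

    If [S] is the set of numbers that occur only finitely often in a sufficiently generic
    sequence [O], then [O] is good: a finite part of [O] does not decide the membership of
    any new number in [S], and a promise that some numbers no longer occur does not prevent
    further numbers from being put into [S]. As [S] is Sigma_2 in [O], it remains to solve an
    instance of Ramsey's theorem computable in a good [Z] by a set [H] with [Z] join [H] good,
    and to iterate this. The solution is obtained from a cohesive set followed by an infinite subset
    of one side of a partition which is Delta_2. Both come from one Mathias forcing. In it, good
    reservoirs are members of Pi_1 classes, and the Sigma_1 half of goodness is preserved by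
    the question whether every partition of the reservoir leaves room for a success. For the
    Sigma_2 half, a condition carries an ideal of sets that are too small to be reservoirs:
    the sets forcing a success generate an ideal; if it contains the reservoir, the
    partition that witnesses this is found in a Pi_1 class, and otherwise the
    ideal is added to the condition and no success is possible. Finding the partition is a
    Sigma_2 question because the sides are Delta_2, and that is where an arbitrary Sigma_2 set
    would not do.

    Computability is replaced by computability relative to a countable class of predicates
    closed under first-order definability ([Def]); the argument relativizes, and only the
    use of the oracle has to be controlled. *)

Set Implicit Arguments.
Unset Strict Implicit.
Unset Printing Implicit Defensive.

Local Open Scope classical_set_scope.

(** * Predicates definable from the ground model *)

Definition npair (a b : nat) : nat := CodeSeq.code [:: a; b].
Definition nfst (n : nat) : nat := nth 0 (CodeSeq.decode n) 0.
Definition nsnd (n : nat) : nat := nth 0 (CodeSeq.decode n) 1.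


Lemma nfstK a b : nfst (npair a b) = a.
Proof. by rewrite /nfst CodeSeq.codeK. Qed.

Lemma nsndK a b : nsnd (npair a b) = b.
Proof. by rewrite /nsnd CodeSeq.codeK. Qed.

(** Every number names an element through [dc], possibly one with many names, so quantifiers over
    [T] become quantifiers over all numbers. *)
Class coded (T : Type) := Coded { dc : nat -> T; ec : T -> nat; dcK : cancel ec dc }.

#[global] Instance coded_nat : coded nat := @Coded nat id id (fun => erefl).

#[global, refine] Instance coded_prod T U (cT : coded T) (cU : coded U) : coded (T * U) :=
  @Coded _ (fun n => (dc (nfst n), dc (nsnd n))) (fun p => npair (ec p.1) (ec p.2)) _.
Proof. by case=> a b /=; rewrite nfstK nsndK !dcK. Defined.

#[global] Instance coded_seq : coded (seq nat) :=
  @Coded _ CodeSeq.decode CodeSeq.code CodeSeq.codeK.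

#[global, refine] Instance coded_bool : coded bool :=
  @Coded _ (fun n => n == 1) nat_of_bool _.
Proof. by case. Defined.

Definition on_codes A B C {cA : coded A} {cB : coded B} {cC : coded C}
  (g : A -> B -> C) (n : nat) : nat := ec (g (dc (nfst n)) (dc (nsnd n))).

Definition base_functions : seq (nat -> nat) :=
  [:: nfst; nsnd; succn; on_codes addn; on_codes muln; on_codes leq;
      (fun n => size (CodeSeq.decode n)); on_codes (fun (s : seq nat) i => nth 0 s i);
      on_codes (fun i (s : seq nat) => take i s); on_codes (fun a (s : seq nat) => a :: s);
      on_codes (@cat nat)].

Inductive fcode : Type :=
| Fid | Fconst of nat | Fbase of nat | Fcomp of fcode & fcode | Fpair of fcode & fcode.

(** First-order formulas over [base_functions]. All free variables sit in one number, as nested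
    pairs, and [Pex] appends the bound variable as a last component. *)
Inductive pcode : Type :=
| Peq of fcode & fcode | Pnot of pcode | Pand of pcode & pcode | Pex of pcode.

Fixpoint fden (f : fcode) (n : nat) : nat :=
  match f with
  | Fid => n
  | Fconst c => c
  | Fbase i => nth id base_functions i n
  | Fcomp f g => fden f (fden g n)
  | Fpair f g => npair (fden f n) (fden g n)
  end.

Fixpoint pden (p : pcode) (n : nat) : Prop :=
  match p with
  | Peq f g => fden f n = fden g n
  | Pnot p => ~ pden p n
  | Pand p q => pden p n /\ pden q n
  | Pex p => exists k, pden p (npair n k)
  end.

Fixpoint psub (p : pcode) (f : fcode) : pcode :=
  match p with
  | Peq a b => Peq (Fcomp a f) (Fcomp b f)
  | Pnot p => Pnot (psub p f)
  | Pand p q => Pand (psub p f) (psub q f)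
  | Pex p => Pex (psub p (Fpair (Fcomp f (Fbase 0)) (Fbase 1)))
  end.

Lemma pden_psub p f n : pden (psub p f) n <-> pden p (fden f n).
Proof.
elim: p f n => [a b|p IH|p IHp q IHq|p IH] f n //=.
- by rewrite IH.
- by rewrite IHp IHq.
- by split=> -[k hk]; exists k; move: hk; rewrite IH /= nfstK nsndK.
Qed.

Fixpoint fcode_tree (f : fcode) : GenTree.tree nat :=
  match f with
  | Fid => GenTree.Node 0 [::]
  | Fconst c => GenTree.Node 1 [:: GenTree.Leaf c]
  | Fbase c => GenTree.Node 2 [:: GenTree.Leaf c]
  | Fcomp f g => GenTree.Node 3 [:: fcode_tree f; fcode_tree g]
  | Fpair f g => GenTree.Node 4 [:: fcode_tree f; fcode_tree g]
  end.

Fixpoint tree_fcode (t : GenTree.tree nat) : fcode :=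
  match t with
  | GenTree.Node 1 [:: GenTree.Leaf c] => Fconst c
  | GenTree.Node 2 [:: GenTree.Leaf c] => Fbase c
  | GenTree.Node 3 [:: a; b] => Fcomp (tree_fcode a) (tree_fcode b)
  | GenTree.Node 4 [:: a; b] => Fpair (tree_fcode a) (tree_fcode b)
  | _ => Fid
  end.

Lemma fcode_treeK : cancel fcode_tree tree_fcode.
Proof. by elim=> //= [a -> b ->|a -> b ->]. Qed.

Fixpoint pcode_tree (p : pcode) : GenTree.tree nat :=
  match p with
  | Peq f g => GenTree.Node 0 [:: fcode_tree f; fcode_tree g]
  | Pnot p => GenTree.Node 1 [:: pcode_tree p]
  | Pand p q => GenTree.Node 2 [:: pcode_tree p; pcode_tree q]
  | Pex p => GenTree.Node 3 [:: pcode_tree p]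
  end.

Fixpoint tree_pcode (t : GenTree.tree nat) : pcode :=
  match t with
  | GenTree.Node 0 [:: f; g] => Peq (tree_fcode f) (tree_fcode g)
  | GenTree.Node 1 [:: p] => Pnot (tree_pcode p)
  | GenTree.Node 2 [:: p; q] => Pand (tree_pcode p) (tree_pcode q)
  | GenTree.Node 3 [:: p] => Pex (tree_pcode p)
  | _ => Peq Fid Fid
  end.

Lemma pcode_treeK : cancel pcode_tree tree_pcode.
Proof. by elim=> //= [f g|p ->|p -> q ->|p ->]; rewrite ?fcode_treeK. Qed.

Definition den (n : nat) : nat -> Prop :=
  pden (if unpickle n is Some t then tree_pcode t else Peq Fid Fid).

Lemma den_surj p : exists n, den n = pden p.
Proof.
by exists (pickle (pcode_tree p)); rewrite /den pickleK pcode_treeK.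
Qed.

(** * Definable predicates and functions on coded types *)

Section Definable.
Context {T U : Type} {cT : coded T} {cU : coded U}.

Definition Def (P : T -> Prop) := exists c, forall n, P (dc n) <-> pden c n.

Definition Deff (f : T -> U) := exists c, forall n, f (dc n) = dc (fden c n).
End Definable.

(* A code defines a predicate on [T] only if it does not distinguish two names of the same
   element; the other codes are read as the empty predicate. *)
Definition holds T {cT : coded T} (c : nat) (t : T) : Prop :=
  (forall n m, dc n = dc m :> T -> den c n <-> den c m) /\ den c (ec t).

Lemma dc_npair T U (cT : coded T) (cU : coded U) a b :
  dc (npair a b) = (dc a : T, dc b : U).
Proof. by rewrite /= nfstK nsndK. Qed.

Lemma Def_holds T (cT : coded T) (P : T -> Prop) : Def P -> exists c, forall t, P t <-> holds c t.
Proof.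
move=> [c hc]; have [n hn] := den_surj c; exists n => t.
rewrite /holds hn -hc dcK; split=> [p|[]//]; split=> // i j e.
by rewrite -!hc e.
Qed.

Lemma Def_ext T (cT : coded T) (P Q : T -> Prop) : (forall t, P t <-> Q t) -> Def P -> Def Q.
Proof. by move=> h [c hc]; exists c => n; rewrite -h. Qed.

Lemma Def_not T (cT : coded T) (P : T -> Prop) : Def P -> Def (fun t => ~ P t).
Proof. by move=> [c hc]; exists (Pnot c) => n /=; rewrite hc. Qed.

Lemma Def_and T (cT : coded T) (P Q : T -> Prop) : Def P -> Def Q -> Def (fun t => P t /\ Q t).
Proof. by move=> [c hc] [d hd]; exists (Pand c d) => n /=; rewrite hc hd. Qed.

Lemma Def_imp T (cT : coded T) (P Q : T -> Prop) : Def P -> Def Q -> Def (fun t => P t -> Q t).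
Proof.
move=> hP hQ; have := Def_not (Def_and hP (Def_not hQ)).
apply: Def_ext => t; split; last by tauto.
by move=> h p; apply: contrapT => q; apply: h.
Qed.

Lemma Def_or T (cT : coded T) (P Q : T -> Prop) : Def P -> Def Q -> Def (fun t => P t \/ Q t).
Proof.
move=> hP hQ; have := Def_imp (Def_not hP) hQ; apply: Def_ext => t.
by split; [case: (pselect (P t)); tauto | tauto].
Qed.

Lemma Def_ex T U (cT : coded T) (cU : coded U) (P : T -> U -> Prop) :
  Def (fun x => P x.1 x.2) -> Def (fun t => exists u, P t u).
Proof.
move=> [c hc]; exists (Pex c) => n /=; split.
  by move=> [u hu]; exists (ec u); rewrite -hc dc_npair /= dcK.
by move=> [k]; rewrite -hc dc_npair => hk; exists (dc k).
Qed.

Lemma Def_all T U (cT : coded T) (cU : coded U) (P : T -> U -> Prop) :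
  Def (fun x => P x.1 x.2) -> Def (fun t => forall u, P t u).
Proof.
move=> /Def_not /(@Def_ex _ _ _ _ (fun t u => ~ P t u)) /Def_not.
apply: Def_ext => t; split=> [h u|h [u hu]]; last exact: hu.
by apply: contrapT => hn; apply: h; exists u.
Qed.

Lemma Def_comp T U (cT : coded T) (cU : coded U) (P : U -> Prop) (f : T -> U) :
  Def P -> Deff f -> Def (fun t => P (f t)).
Proof.
move=> [c hc] [d hd]; exists (psub c d) => n.
by rewrite pden_psub -hc hd.
Qed.

Lemma Def_eq T (cT : coded T) (f g : T -> nat) : Deff f -> Deff g -> Def (fun t => f t = g t).
Proof. by move=> [c hc] [d hd]; exists (Peq c d) => n /=; rewrite hc hd. Qed.

Lemma Def_true T (cT : coded T) (f : T -> bool) : Deff f -> Def (fun t => f t).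
Proof.
move=> [c hc]; exists (Peq c (Fconst 1)) => n /=; rewrite hc.
by split=> /eqP.
Qed.

(** The truth value of a fixed proposition is settled classically, so one of two constant formulas
    defines it; definability is nonuniform in such parameters. *)
Lemma Def_prop T (cT : coded T) (P : Prop) : Def (fun _ : T => P).
Proof.
case: (pselect P) => h; first by exists (Peq Fid Fid).
by exists (Pnot (Peq Fid Fid)) => n /=; tauto.
Qed.

Lemma Deff_id T (cT : coded T) : Deff (fun t : T => t).
Proof. by exists Fid. Qed.

Lemma Deff_const T U (cT : coded T) (cU : coded U) (u : U) : Deff (fun _ : T => u).
Proof. by exists (Fconst (ec u)) => n; rewrite dcK. Qed.

Lemma Deff_comp T U V (cT : coded T) (cU : coded U) (cV : coded V) (f : U -> V) (g : T -> U) :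
  Deff f -> Deff g -> Deff (fun t => f (g t)).
Proof. by move=> [c hc] [d hd]; exists (Fcomp c d) => n /=; rewrite hd hc. Qed.

Lemma Deff_pair T U V (cT : coded T) (cU : coded U) (cV : coded V) (f : T -> U) (g : T -> V) :
  Deff f -> Deff g -> Deff (fun t => (f t, g t)).
Proof. by move=> [c hc] [d hd]; exists (Fpair c d) => n; rewrite dc_npair hd hc. Qed.

Lemma Deff_fst T U V (cT : coded T) (cU : coded U) (cV : coded V) (f : T -> U * V) :
  Deff f -> Deff (fun t => (f t).1).
Proof. by move=> [c hc]; exists (Fcomp (Fbase 0) c) => n; rewrite hc. Qed.

Lemma Deff_snd T U V (cT : coded T) (cU : coded U) (cV : coded V) (f : T -> U * V) :
  Deff f -> Deff (fun t => (f t).2).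
Proof. by move=> [c hc]; exists (Fcomp (Fbase 1) c) => n; rewrite hc. Qed.

Lemma Deff_base2 T A B C (cT : coded T) (cA : coded A) (cB : coded B) (cC : coded C)
    (g : A -> B -> C) i (a : T -> A) (b : T -> B) :
  nth id base_functions i = on_codes g -> Deff a -> Deff b -> Deff (fun t => g (a t) (b t)).
Proof.
move=> hi [c hc] [d hd]; exists (Fcomp (Fbase i) (Fpair c d)) => n /=.
by rewrite hi /on_codes nfstK nsndK dcK hc hd.
Qed.

Lemma Deff_nfst T (cT : coded T) (f : T -> nat) : Deff f -> Deff (fun t => nfst (f t)).
Proof. by move=> [c hc]; exists (Fcomp (Fbase 0) c) => n; rewrite hc. Qed.

Lemma Deff_nsnd T (cT : coded T) (f : T -> nat) : Deff f -> Deff (fun t => nsnd (f t)).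
Proof. by move=> [c hc]; exists (Fcomp (Fbase 1) c) => n; rewrite hc. Qed.

Lemma Deff_npair T (cT : coded T) (f g : T -> nat) :
  Deff f -> Deff g -> Deff (fun t => npair (f t) (g t)).
Proof. by move=> [c hc] [d hd]; exists (Fpair c d) => n /=; rewrite hc hd. Qed.

Lemma Deff_ec T U (cT : coded T) (cU : coded U) (f : T -> nat) :
  Deff f -> Deff (fun t => dc (f t) : U).
Proof. by move=> [c hc]; exists c => n; rewrite hc. Qed.

Lemma Deff_succ T (cT : coded T) (f : T -> nat) : Deff f -> Deff (fun t => (f t).+1).
Proof. by move=> [c hc]; exists (Fcomp (Fbase 2) c) => n /=; rewrite hc. Qed.

Lemma Deff_add T (cT : coded T) (f g : T -> nat) : Deff f -> Deff g -> Deff (fun t => f t + g t).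
Proof. exact: (@Deff_base2 _ _ _ _ _ _ _ _ addn 3). Qed.

Lemma Deff_mul T (cT : coded T) (f g : T -> nat) : Deff f -> Deff g -> Deff (fun t => f t * g t).
Proof. exact: (@Deff_base2 _ _ _ _ _ _ _ _ muln 4). Qed.

Lemma Deff_leq T (cT : coded T) (f g : T -> nat) : Deff f -> Deff g -> Deff (fun t => f t <= g t).
Proof. exact: (@Deff_base2 _ _ _ _ _ _ _ _ leq 5). Qed.

Lemma Deff_size T (cT : coded T) (f : T -> seq nat) : Deff f -> Deff (fun t => size (f t)).
Proof. by move=> [c hc]; exists (Fcomp (Fbase 6) c) => n /=; rewrite hc. Qed.

Lemma Deff_nth T (cT : coded T) (f : T -> seq nat) (g : T -> nat) :
  Deff f -> Deff g -> Deff (fun t => nth 0 (f t) (g t)).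
Proof. exact: (@Deff_base2 _ _ _ _ _ _ _ _ (fun (s : seq nat) i => nth 0 s i) 7). Qed.

Lemma Deff_take T (cT : coded T) (g : T -> nat) (f : T -> seq nat) :
  Deff g -> Deff f -> Deff (fun t => take (g t) (f t)).
Proof. exact: (@Deff_base2 _ _ _ _ _ _ _ _ (fun i (s : seq nat) => take i s) 8). Qed.

Lemma Deff_cons T (cT : coded T) (g : T -> nat) (f : T -> seq nat) :
  Deff g -> Deff f -> Deff (fun t => g t :: f t).
Proof. exact: (@Deff_base2 _ _ _ _ _ _ _ _ (fun a (s : seq nat) => a :: s) 9). Qed.

Lemma Deff_cat T (cT : coded T) (g f : T -> seq nat) :
  Deff g -> Deff f -> Deff (fun t => g t ++ f t).
Proof. exact: (@Deff_base2 _ _ _ _ _ _ _ _ (@cat nat) 10). Qed.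

(** For fixed [r] the clause of [holds] about names is a proposition without [t] and can be decided
    in advance. Nothing is claimed uniformly in [r]. *)
Lemma Def_den T (cT : coded T) r : Def (fun t : T => holds r t).
Proof.
case: (pselect (forall n m, dc n = dc m :> T -> den r n <-> den r m)) => v.
  rewrite /holds /den; set p := if _ is Some _ then _ else _; exists p => n.
  by have -> : pden p n <-> pden p (ec (dc n : T)); [apply: v; rewrite dcK|split=> [[]|]].
by apply: Def_ext (Def_prop _ False) => t; split=> // -[].
Qed.

Ltac deff_step :=
  lazymatch goal with
  | |- Deff (fun _ => npair _ _) => apply: Deff_npair
  | |- Deff (fun _ => nfst _) => apply: Deff_nfst
  | |- Deff (fun _ => nsnd _) => apply: Deff_nsnd
  | |- Deff (fun _ => leq _ _) => apply: Deff_leq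
  | |- Deff (fun _ => S _) => apply: Deff_succ
  | |- Deff (fun _ => addn _ _) => apply: Deff_add
  | |- Deff (fun _ => muln _ _) => apply: Deff_mul
  | |- Deff (fun _ => size _) => apply: Deff_size
  | |- Deff (fun _ => nth _ _ _) => apply: Deff_nth
  | |- Deff (fun _ => take _ _) => apply: Deff_take
  | |- Deff (fun _ => (_, _)) => apply: Deff_pair
  | |- Deff (fun _ => _ :: _) => apply: Deff_cons
  | |- Deff (fun _ => _ ++ _) => apply: Deff_cat
  | |- Deff (fun _ => (_).1) => apply: Deff_fst
  | |- Deff (fun _ => (_).2) => apply: Deff_snd
  | |- Deff (fun x => x) => apply: Deff_id
  | |- Deff (fun x => dc _) => apply: Deff_ec
  | |- Deff (fun _ => CodeSeq.decode _) => apply: (@Deff_ec _ _ _ coded_seq)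
  | |- Deff fst => apply: (Deff_fst (Deff_id _))
  | |- Deff snd => apply: (Deff_snd (Deff_id _))
  | |- Deff nfst => apply: (Deff_nfst (Deff_id _))
  | |- Deff nsnd => apply: (Deff_nsnd (Deff_id _))
  | |- Deff size => apply: (Deff_size (Deff_id _))
  | |- Deff succn => apply: (Deff_succ (Deff_id _))
  end.

Ltac deff := repeat first [ assumption | apply: Deff_const | deff_step ].

Ltac def := repeat first
  [ apply: Def_prop | assumption
  | apply: Def_ex => /= | apply: Def_all => /= | apply: Def_and | apply: Def_or | apply: Def_not | apply: Def_imp
  | (apply: Def_eq; deff; fail) | (apply: Def_true; deff; fail)
  | (match goal with H : Def ?R |- Def (fun t => ?R _) => apply: (Def_comp H); deff end) ].

(** * Relations that are Sigma_1 or Sigma_2 in an oracle *)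

Lemma take_mkseq (f : nat -> nat) i l : take i (mkseq f l) = mkseq f (minn i l).
Proof.
rewrite /mkseq -map_take; congr map.
case: (leqP i l) => h; first by rewrite take_iota (minn_idPl h).
by rewrite take_oversize ?size_iota 1?ltnW.
Qed.

Lemma take_mkseq_le (f : nat -> nat) i l : i <= l -> take i (mkseq f l) = mkseq f i.
Proof. by move=> h; rewrite take_mkseq (minn_idPl h). Qed.

Lemma bounded_choice (b : nat) (Q : nat -> nat -> Prop) :
  (forall u l l', l <= l' -> Q u l -> Q u l') ->
  (forall u, u < b -> exists l, Q u l) -> exists l, forall u, u < b -> Q u l.
Proof.
move=> mono; elim: b => [|b IH] h; first by exists 0.
have [l hl] := IH (fun u hu => h u (ltnW hu)).
have [l' hl'] := h b (ltnSn b).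
exists (maxn l l') => u; rewrite ltnS leq_eqVlt => /orP[/eqP->|hu].
  exact: mono (leq_maxr _ _) hl'.
exact: mono (leq_maxl _ _) (hl _ hu).
Qed.

Lemma bounded_seq (b : nat) (Q : nat -> nat -> Prop) :
  (forall u, u < b -> exists a, Q u a) ->
  exists s : seq nat, forall u, u < b -> Q u (nth 0 s u).
Proof.
move=> h; have /choice[f hf] : forall u, exists a, u < b -> Q u a.
  by move=> u; case: (pselect (u < b)) => [/h[a ha]|hu]; [exists a|exists 0].
by exists (mkseq f b) => u hu; rewrite nth_mkseq //; apply: hf.
Qed.

(* The relation is Sigma_1 in [O], and uniformly so in a second oracle [h]. *)
Definition S1 T {cT : coded T} (O : nat -> nat) (P : T -> (nat -> nat) -> Prop) :=
  exists R : T * (seq nat * seq nat) -> Prop,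
    Def R /\ forall t h, P t h <-> exists l, R (t, (mkseq O l, mkseq h l)).

Section S1.
Context {T U : Type} {cT : coded T} {cU : coded U}.
Variable O : nat -> nat.
Implicit Types P Q : T -> (nat -> nat) -> Prop.

Lemma S1_ext P Q : (forall t h, P t h <-> Q t h) -> S1 O P -> S1 O Q.
Proof. by move=> h [R [hR e]]; exists R; split=> // t f; rewrite -h. Qed.

Lemma S1_def (P : T -> Prop) : Def P -> S1 O (fun t _ => P t).
Proof.
move=> hP; exists (fun x => P x.1); split; first by apply: (Def_comp hP); deff.
by move=> t h; split=> [|[]//]; exists 0.
Qed.

Lemma S1_ex (P : T -> U -> (nat -> nat) -> Prop) :
  S1 O (fun x : T * U => P x.1 x.2) -> S1 O (fun t h => exists u, P t u h).
Proof.
move=> [R [hR e]]; exists (fun x => exists u, R ((x.1, u), x.2)); split; first by def.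
move=> t h; split=> [[u /(e (t, u))[l hl]]|[l [u hl]]]; first by exists l, u.
by exists u; apply/(e (t, u)); exists l.
Qed.

Lemma S1_or P Q : S1 O P -> S1 O Q -> S1 O (fun t h => P t h \/ Q t h).
Proof.
move=> [R [hR e]] [R' [hR' e']]; exists (fun x => R x \/ R' x); split; first by def.
move=> t h; rewrite e e'; split=> [[[l]|[l]]|[l []]]; first [by exists l; left|by exists l; right|by left; exists l|by right; exists l].
Qed.

(** [R] need not be monotone in the segment, so each conjunct looks for its own length inside a
    common longer segment. *)
Lemma S1_and P Q : S1 O P -> S1 O Q -> S1 O (fun t h => P t h /\ Q t h).
Proof.
move=> [R [hR e]] [R' [hR' e']].
exists (fun x => exists l l', R (x.1, (take l x.2.1, take l x.2.2)) /\
                      R' (x.1, (take l' x.2.1, take l' x.2.2))); split; first by def.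
move=> t h; rewrite e e'; split=> [[[l hl] [l' hl']]|[L [l [l' /=]]]].
  exists (maxn l l'), l, l'; rewrite /= !take_mkseq_le ?leq_maxl ?leq_maxr //.
by rewrite !take_mkseq => -[hl hl']; split; [exists (minn l L)|exists (minn l' L)].
Qed.

Lemma S1_ball (P : T -> nat -> (nat -> nat) -> Prop) (b : T -> nat) :
  Deff b -> S1 O (fun x : T * nat => P x.1 x.2) ->
  S1 O (fun t h => forall u, u < b t -> P t u h).
Proof.
move=> hb [R [hR e]].
exists (fun x => forall u, u < b x.1 -> exists l, R ((x.1, u), (take l x.2.1, take l x.2.2))).
split.
  have hb' : Deff (fun x : T * (seq nat * seq nat) * nat => b x.1.1).
    by apply: (Deff_comp hb); deff.
  by def.
move=> t h; split=> [H|[l H] u hu]; last first.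
  by have [l' /=] := H u hu; rewrite !take_mkseq => hl; apply/(e (t, u)); exists (minn l' l).
have [||L hL] := @bounded_choice (b t) (fun u L => exists l, l <= L /\ R ((t, u), (mkseq O l, mkseq h l))).
- by move=> u l l' hl [k [hk ?]]; exists k; split=> //; apply: leq_trans hl.
- by move=> u hu; have /(e (t, u))[l hl] := H u hu; exists l, l.
exists L => u hu; have [l [hl hR']] := hL u hu.
by exists l; rewrite /= !take_mkseq_le.
Qed.

Lemma S1_evalO (a b : T -> nat) : Deff a -> Deff b -> S1 O (fun t _ => O (a t) = b t).
Proof.
move=> ha hb.
exists (fun x => a x.1 < size x.2.1 /\ nth 0 x.2.1 (a x.1) = b x.1); split.
  have ha' : Deff (fun x : T * (seq nat * seq nat) => a x.1) by apply: (Deff_comp ha); deff.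
  have hb' : Deff (fun x : T * (seq nat * seq nat) => b x.1) by apply: (Deff_comp hb); deff.
  by def.
move=> t h; split=> [e|[l /=]]; last by rewrite size_mkseq => -[hl]; rewrite nth_mkseq.
have [l hl] : exists l, a t < l by exists (a t).+1.
by exists l; rewrite /= size_mkseq nth_mkseq.
Qed.

Lemma S1_evalh (a b : T -> nat) : Deff a -> Deff b -> S1 O (fun t h => h (a t) = b t).
Proof.
move=> ha hb.
exists (fun x => a x.1 < size x.2.2 /\ nth 0 x.2.2 (a x.1) = b x.1); split.
  have ha' : Deff (fun x : T * (seq nat * seq nat) => a x.1) by apply: (Deff_comp ha); deff.
  have hb' : Deff (fun x : T * (seq nat * seq nat) => b x.1) by apply: (Deff_comp hb); deff.
  by def.
move=> t h; split=> [e|[l /=]]; last by rewrite size_mkseq => -[hl]; rewrite nth_mkseq.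
have [l hl] : exists l, a t < l by exists (a t).+1.
by exists l; rewrite /= size_mkseq nth_mkseq.
Qed.

End S1.

Lemma S1_comp T U (cT : coded T) (cU : coded U) O (P : U -> (nat -> nat) -> Prop) (f : T -> U) :
  S1 O P -> Deff f -> S1 O (fun t => P (f t)).
Proof.
move=> [R [hR e]] hf; exists (fun x => R (f x.1, x.2)); split; last by move=> t h; rewrite e.
have hf' : Deff (fun x : T * (seq nat * seq nat) => f x.1) by apply: (Deff_comp hf); deff.
by def.
Qed.

Ltac s1 := repeat first
  [ assumption
  | (apply: S1_def; def; fail)
  | (match goal with H : S1 ?O ?R |- S1 ?O (fun t h => ?R _ h) => apply: (S1_comp H); deff end)
  | apply: S1_ex => /= | (apply: S1_ball => /=; [deff; fail|]) | apply: S1_and | apply: S1_or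
  | (apply: S1_evalO; deff; fail) | (apply: S1_evalh; deff; fail) 
  ].

Definition is_mkseq (f : nat -> nat) l (s : seq nat) :=
  size s = l /\ forall i, i < l -> f i = nth 0 s i.

Lemma is_mkseqP f l s : is_mkseq f l s <-> s = mkseq f l.
Proof.
split=> [[hs h]|->]; last by split=> [|i hi]; rewrite ?size_mkseq ?nth_mkseq.
by apply: (@eq_from_nth _ 0) => [|i]; rewrite ?size_mkseq // hs => hi; rewrite nth_mkseq ?h.
Qed.

Lemma is_mkseq_exact f l : is_mkseq f l (mkseq f l).
Proof. exact/is_mkseqP. Qed.

Lemma S1_mkseq T (cT : coded T) O (F : T -> (nat -> nat) -> nat -> nat) (l : T -> nat) (s : T -> seq nat) :
  S1 O (fun x : T * nat * nat => fun h => F x.1.1 h x.1.2 = x.2) ->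
  Deff l -> Deff s -> S1 O (fun t h => is_mkseq (F t h) (l t) (s t)).
Proof.
move=> hF hl hs; apply: S1_and; first by s1.
apply: S1_ball => //.
have hs' : Deff (fun x : T * nat => s x.1) by apply: (Deff_comp hs); deff.
apply: (@S1_comp _ _ _ _ _ (fun x h => F x.1.1 h x.1.2 = x.2) (fun x : T * nat => (x, nth 0 (s x.1) x.2)) hF).
by deff.
Qed.

(** A Sigma_1 fact about [O'] and [F t h] depends on finite segments of them, and a guessed segment
    is verified by [S1] facts because both graphs are [S1]. *)
Lemma S1_subst T (cT : coded T) O O' (P : T -> (nat -> nat) -> Prop)
    (F : T -> (nat -> nat) -> nat -> nat) :
  S1 O (fun (x : nat * nat) _ => O' x.1 = x.2) ->
  S1 O (fun x : T * nat * nat => fun h => F x.1.1 h x.1.2 = x.2) ->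
  S1 O' P -> S1 O (fun t h => P t (F t h)).
Proof.
move=> hO hF [R [hR e]].
apply: (@S1_ext _ _ _ (fun t h => exists l s s', is_mkseq O' l s /\ is_mkseq (F t h) l s' /\ R (t, (s, s')))).
  move=> t h; rewrite e; split=> [[l [s [s' [/is_mkseqP-> [/is_mkseqP-> hl]]]]]|[l hl]]; first by exists l.
  by exists l, (mkseq O' l), (mkseq (F t h) l); split; [exact: is_mkseq_exact|split=> //; exact: is_mkseq_exact].
apply: S1_ex; apply: S1_ex; apply: S1_ex => /=; apply: S1_and.
  apply: (@S1_mkseq _ _ _ (fun _ _ => O')); [|deff..].
  by apply: (@S1_comp _ _ _ _ _ _ (fun x : _ * nat * nat => (x.1.2, x.2)) hO); deff.
apply: S1_and; last by s1.
apply: (@S1_mkseq _ _ _ (fun x => F x.1.1.1)); [|deff..].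
apply: (@S1_comp _ _ _ _ _ (fun x h => F x.1.1 h x.1.2 = x.2) (fun x : T * nat * seq nat * seq nat * nat * nat => ((x.1.1.1.1.1, x.1.2), x.2)) hF).
by deff.
Qed.

(** Reducibility: a total function is computed from [O] once its graph is enumerated from [O]. *)
Definition reads (O O' : nat -> nat) := S1 O (fun (x : nat * nat) _ => O' x.1 = x.2).

Lemma S1_reads T (cT : coded T) O O' (P : T -> (nat -> nat) -> Prop) :
  reads O O' -> S1 O' P -> S1 O P.
Proof.
move=> hO; apply: (@S1_subst _ _ _ _ P (fun _ h => h)) => //; by s1.
Qed.

Lemma S1_at T (cT : coded T) O O' f (P : T -> (nat -> nat) -> Prop) :
  reads O O' -> reads O f -> S1 O' P -> S1 O (fun t _ => P t f).
Proof.
move=> hO hf; apply: (@S1_subst _ _ _ _ P (fun _ _ => f)) => //.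
by apply: (@S1_comp _ _ _ _ _ _ (fun x : T * nat * nat => (x.1.2, x.2)) hf); deff.
Qed.

Lemma reads_refl O : reads O O. Proof. by rewrite /reads; s1. Qed.

Lemma reads_trans O1 O2 O3 : reads O1 O2 -> reads O2 O3 -> reads O1 O3.
Proof. exact: S1_reads. Qed.

Definition join (O h : nat -> nat) : nat -> nat := fun n => npair (O n) (h n).

Lemma reads_joinl O h : reads (join O h) O.
Proof.
apply: (@S1_ext _ _ _ (fun x _ => exists v, join O h x.1 = v /\ nfst v = x.2)); last by s1.
move=> [n v] /= _; split=> [[w [<-]]|<-]; first by rewrite /join nfstK.
by exists (join O h n); rewrite /join nfstK.
Qed.

Lemma reads_joinr O h : reads (join O h) h.
Proof.
apply: (@S1_ext _ _ _ (fun x _ => exists v, join O h x.1 = v /\ nsnd v = x.2)); last by s1.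
move=> [n v] /= _; split=> [[w [<-]]|<-]; first by rewrite /join nsndK.
by exists (join O h n); rewrite /join nsndK.
Qed.

Lemma reads_join O f g : reads O f -> reads O g -> reads O (join f g).
Proof.
move=> hf hg; apply: (@S1_ext _ _ _ (fun x _ => exists v w, f x.1 = v /\ g x.1 = w /\ npair v w = x.2)).
  move=> [n u] _ /=; split=> [[v [w [<- [<- <-]]]]|<-] //; by exists (f n), (g n).
apply: S1_ex; apply: S1_ex; apply: S1_and => /=.
  by apply: (@S1_comp _ _ _ _ _ _ (fun x : nat * nat * nat * nat => (x.1.1.1, x.1.2)) hf); deff.
apply: S1_and; last by s1.
by apply: (@S1_comp _ _ _ _ _ _ (fun x : nat * nat * nat * nat => (x.1.1.1, x.2)) hg); deff.
Qed.

(** Koenig's lemma. If no [L] works, the strings that are [bad] form a tree without dead ends, and a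
    branch through it never enters [B]. *)
Lemma compactness K (B : seq nat -> Prop) :
  (forall h, (forall x, h x < K) -> exists l, B (mkseq h l)) ->
  exists L, forall h, (forall x, h x < K) -> exists l, l <= L /\ B (mkseq h l).
Proof.
move=> hB; apply: contrapT => hn.
pose bad s := forall L, exists h, [/\ forall x, h x < K, mkseq h (size s) = s
   & forall l, l <= L -> ~ B (mkseq h l)].
have bad0 : bad [::].
  move=> L; apply: contrapT => hL; apply: hn; exists L => h hK.
  apply: contrapT => hl; apply: hL; exists h; split=> // l hlL hBl.
  by apply: hl; exists l.
have step s : bad s -> exists v, v < K /\ bad (rcons s v).
  move=> hs; apply: contrapT => hv.
  have [||L hL] := @bounded_choice K (fun v L => ~ exists h, [/\ forall x, h x < K,
     mkseq h (size (rcons s v)) = rcons s v & forall l, l <= L -> ~ B (mkseq h l)]).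
  - move=> u l l' hl hu [h [h1 h2 h3]]; apply: hu; exists h; split=> // k hk.
    by apply: h3; apply: leq_trans hl.
  - move=> v hvK; apply: contrapT => hL; apply: hv; exists v; split=> // L.
    by apply: contrapT => hL'; apply: hL; exists L.
  have [h [h1 h2 h3]] := hs L.
  apply: (hL (h (size s)) (h1 _)); exists h; split=> //.
  by rewrite size_rcons mkseqS h2.
have /choice[nx hnx] : forall s : {s | bad s}, exists t : {s | bad s},
    exists2 v, v < K & sval t = rcons (sval s) v.
  by move=> [s hs]; have [v [hv hs']] := step s hs; exists (exist _ (rcons s v) hs'), v.
pose t n := iter n nx (exist _ [::] bad0).
pose h n := nth 0 (sval (t n.+1)) n.
have st n : size (sval (t n)) = n.
  by elim: n => //= n IH; have [v _ ->] := hnx (t n); rewrite size_rcons IH.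
have ht n : mkseq h n = sval (t n).
  elim: n => [|n IH]; first by rewrite /t /=.
  rewrite mkseqS IH /h /=; have [v _ ->] := hnx (t n).
  by rewrite nth_rcons st ltnn eqxx.
have hK n : h n < K.
  by rewrite /h /=; have [v hv ->] := hnx (t n); rewrite nth_rcons st ltnn eqxx.
have [l hl] := hB h hK.
have /(_ l)[g [_ hg /(_ l (leqnn _))]] := svalP (t l).
by rewrite st -ht in hg; rewrite hg.
Qed.

(** By compactness one level of the tree of bounded strings suffices, and quantifying over the
    strings of one length is definable. *)
Lemma S1_compact T (cT : coded T) O (N : T -> (nat -> nat) -> Prop) (K : T -> nat) :
  S1 O N -> Deff K -> S1 O (fun t _ => forall h, (forall x, h x < K t) -> N t h).
Proof.
move=> [R [hR e]] hK.
exists (fun x => forall s : seq nat, size s = size x.2.1 -> (forall i, i < size s -> nth 0 s i < K x.1) ->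
   exists l, R (x.1, (take l x.2.1, take l s))); split.
  have hK' : Deff (fun x : T * (seq nat * seq nat) * seq nat * nat => K x.1.1.1) by apply: (Deff_comp hK); deff.
  by def.
move=> t f; split=> [H|[L HL] h hh].
  have [|L hL] := @compactness (K t) (fun s => R (t, (mkseq O (size s), s))).
    by move=> h /H /e[l hl]; exists l; rewrite size_mkseq.
  (* The length is nonzero so that an entry of [s] witnesses [0 < K t]; the extension of [s] by the
     default value 0 then stays below the bound. *)
  exists L.+1 => s; rewrite [size (mkseq _ _)]size_mkseq => hs hsK.
  have K1 : 0 < K t by apply: leq_ltn_trans (hsK 0 _); rewrite ?hs.
  pose h x := nth 0 s x.
  have [|l [hl hR']] := hL h.
    move=> x; case: (ltnP x (size s)) => hx; first exact: hsK.
    by rewrite /h nth_default.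
  exists l; rewrite [(_, take l s)]/= take_mkseq_le ?leqW //; move: hR'; rewrite size_mkseq.
  suff -> : mkseq h l = take l s by [].
  by rewrite -(take_mkseq_le h (leqW hl)) /h -hs mkseq_nth.
have /= := HL (mkseq h L); rewrite !size_mkseq => /(_ erefl)[].
  by move=> i hi; rewrite nth_mkseq.
by move=> l; rewrite !take_mkseq => hl; apply/e; exists (minn l L).
Qed.

Definition S2 T {cT : coded T} (O : nat -> nat) (P : T -> (nat -> nat) -> Prop) :=
  exists N : T * nat -> (nat -> nat) -> Prop,
    S1 O N /\ forall t h, P t h <-> exists a, ~ N (t, a) h.

Section S2.
Context {T U : Type} {cT : coded T} {cU : coded U}.
Variable O : nat -> nat.
Implicit Types P Q : T -> (nat -> nat) -> Prop.

Lemma S2_ext P Q : (forall t h, P t h <-> Q t h) -> S2 O P -> S2 O Q.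
Proof. by move=> h [R [hR e]]; exists R; split=> // t f; rewrite -h. Qed.

Lemma S2_P1 P : S1 O (fun t h => ~ P t h) -> S2 O P.
Proof.
move=> hP; exists (fun x h => ~ P x.1 h); split.
  by apply: (S1_comp hP); deff.
move=> t h; split=> [p|[a /contrapT //]]; by exists 0.
Qed.

Lemma S2_S1 P : S1 O P -> S2 O P.
Proof.
move=> [R [hR e]].
exists (fun x h => ~ R (x.1, (mkseq O x.2, mkseq h x.2))); split.
  exists (fun y => y.1.2 <= size y.2.1 /\ ~ R (y.1.1, (take y.1.2 y.2.1, take y.1.2 y.2.2))); split; first by def.
  move=> [t a] h /=; split=> [hn|[l]]; first by exists a; rewrite !take_mkseq_le ?size_mkseq.
  by rewrite size_mkseq => -[hl]; rewrite !take_mkseq_le.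
move=> t h; rewrite e; split=> -[l hl]; exists l => //=; exact: contrapT.
Qed.

Lemma S2_ex (P : T -> U -> (nat -> nat) -> Prop) :
  S2 O (fun x : T * U => P x.1 x.2) -> S2 O (fun t h => exists u, P t u h).
Proof.
move=> [N [hN e]]; exists (fun x => N ((x.1, dc (nfst x.2)), nsnd x.2)); split.
  by apply: (S1_comp hN); deff.
move=> t h; split=> [[u /(e (t, u))[a ha]]|[a ha]].
  by exists (npair (ec u) a); rewrite /= nfstK nsndK dcK.
by exists (dc (nfst a)); apply/(e (t, _)); exists (nsnd a).
Qed.

Lemma S2_and P Q : S2 O P -> S2 O Q -> S2 O (fun t h => P t h /\ Q t h).
Proof.
move=> [N [hN e]] [M [hM e']].
exists (fun x h => N (x.1, nfst x.2) h \/ M (x.1, nsnd x.2) h); split; first by s1.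
move=> t h; rewrite e e'; split=> [[[a ha] [b hb]]|[a /= ha]].
  by exists (npair a b); rewrite /= nfstK nsndK; tauto.
by split; [exists (nfst a)|exists (nsnd a)]; tauto.
Qed.

Lemma S2_or P Q : S2 O P -> S2 O Q -> S2 O (fun t h => P t h \/ Q t h).
Proof.
move=> [N [hN e]] [M [hM e']].
exists (fun x h => (~ nfst x.2 = 0 \/ N (x.1, nsnd x.2) h) /\ (nfst x.2 = 0 \/ M (x.1, nsnd x.2) h)).
split; first by s1.
move=> t h; rewrite e e'; split=> [[[a ha]|[a ha]]|[a /= ha]].
- by exists (npair 0 a); rewrite /= nfstK nsndK; tauto.
- by exists (npair 1 a); rewrite /= nfstK nsndK => -[_ []].
- case: (pselect (nfst a = 0)) => h0; first by left; exists (nsnd a); tauto.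
  by right; exists (nsnd a); tauto.
Qed.

(** The finitely many witnesses are gathered into one coded sequence, which moves the unbounded
    quantifier outward. *)
Lemma S2_ball (P : T -> nat -> (nat -> nat) -> Prop) (b : T -> nat) :
  Deff b -> S2 O (fun x : T * nat => P x.1 x.2) ->
  S2 O (fun t h => forall u, u < b t -> P t u h).
Proof.
move=> hb [N [hN e]].
exists (fun x h => exists u, u < b x.1 /\ N ((x.1, u), nth 0 (dc x.2) u) h); split.
  apply: S1_ex; apply: S1_and => /=.
    have hb' : Deff (fun x : T * nat * nat => b x.1.1) by apply: (Deff_comp hb); deff.
    by s1.
  by apply: (S1_comp hN); deff.
move=> t h; split=> [H|[a /= ha] u hu]; last first.
  by apply/(e (t, u)); exists (nth 0 (CodeSeq.decode a) u) => hn; apply: ha; exists u.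
have [|s hs] := @bounded_seq (b t) (fun u a => ~ N ((t, u), a) h).
  by move=> u /H /(e (t, u)).
by exists (ec s); rewrite dcK /= => -[u [hu]]; apply: hs.
Qed.

End S2.

Lemma S2_comp T U (cT : coded T) (cU : coded U) O (P : U -> (nat -> nat) -> Prop) (f : T -> U) :
  S2 O P -> Deff f -> S2 O (fun t => P (f t)).
Proof.
move=> [N [hN e]] hf; exists (fun x h => N (f x.1, x.2) h); split; last by move=> t h; rewrite e.
have hf' : Deff (fun x : T * nat => f x.1) by apply: (Deff_comp hf); deff.
by apply: (S1_comp hN); deff.
Qed.

Lemma S2_reads T (cT : coded T) O O' (P : T -> (nat -> nat) -> Prop) :
  reads O O' -> S2 O' P -> S2 O P.
Proof. by move=> hO [N [hN e]]; exists N; split=> //; apply: S1_reads hN. Qed.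

(** * Good oracles *)

(** A universal open relation: [r] indexes a definable set of strings, so that requirements about
    Sigma_1 relations form a countable list. *)
Definition univ T {cT : coded T} (r : nat) (t : T) (f : nat -> nat) : Prop :=
  exists l, holds r (t, mkseq f l).

Definition seq_univ T {cT : coded T} (r : nat) (t : T) (s : seq nat) : Prop :=
  exists l, holds r (t, take l s).

Lemma seq_univ_prefix T (cT : coded T) r (t : T) s s' : prefix s s' -> seq_univ r t s -> seq_univ r t s'.
Proof.
rewrite prefixE => /eqP e [l]; rewrite -e; case: (leqP l (size s)) => h.
  by rewrite take_takel // => hl; exists l.
by rewrite take_taker 1?ltnW // => hl; exists (size s).
Qed.

Lemma univ_seq T (cT : coded T) r (t : T) f : univ r t f <-> exists l, seq_univ r t (mkseq f l).
Proof.
split=> [[l hl]|[l [k]]]; last by rewrite take_mkseq => hk; exists (minn k l).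
by exists l, l; rewrite take_mkseq minnn.
Qed.

Lemma S1_univ T (cT : coded T) O r : S1 O (fun (t : T) h => univ r t h).
Proof.
exists (fun x => holds r (x.1, x.2.2)); split=> //.
by apply: (Def_comp (Def_den _ r)); deff.
Qed.

Lemma S1_universal T (cT : coded T) O (Q : T -> Prop) :
  S1 O (fun t _ => Q t) -> exists r, forall t, Q t <-> univ r t O.
Proof.
move=> [R [hR e]].
(* The second oracle is frozen at zero, and [z] supplies its initial segment. *)
have [|r hr] := @Def_holds _ _ (fun x : T * seq nat =>
   exists z : seq nat, size z = size x.2 /\ (forall i, i < size z -> nth 0 z i = 0) /\ R (x.1, (x.2, z))).
  by def.
exists r => t; rewrite (e t (fun => 0)); split=> -[l hl]; exists l.
  apply/hr; exists (mkseq (fun => 0) l); rewrite !size_mkseq; split=> //; split=> // i hi.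
  by rewrite nth_mkseq.
move/hr: hl => [z]; rewrite !size_mkseq => -[hz [z0]].
suff -> : z = mkseq (fun => 0) l by [].
apply: (@eq_from_nth _ 0) => [|i hi]; first by rewrite size_mkseq.
by rewrite z0 // nth_mkseq // -hz.
Qed.

Lemma compact_union T (cT : coded T) O (N : T * nat -> (nat -> nat) -> Prop) K t :
  S1 O N -> (forall m m' h, m <= m' -> N (t, m) h -> N (t, m') h) ->
  (forall h, (forall x, h x < K) -> exists m, N (t, m) h) ->
  exists m, forall h, (forall x, h x < K) -> N (t, m) h.
Proof.
move=> [R [_ e]] mono hN.
have [|L hL] := @compactness K (fun s => exists m l, [/\ m <= size s, l <= size s & R ((t, m), (mkseq O l, take l s))]).
  move=> h /hN[m /e[l hl]]; exists (maxn l m), m, l.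
  by rewrite size_mkseq leq_maxl leq_maxr take_mkseq_le ?leq_maxl.
exists L => h /hL[l [hl [m [k []]]]]; rewrite size_mkseq => hm hk; rewrite take_mkseq_le // => hR.
by apply: (mono m); [apply: leq_trans hl|apply/e; exists k].
Qed.

(** Each [j] has the number [ec j], and step [ec j] of the construction enters [D j]. *)
Lemma generic_sequence (C J : Type) {cJ : coded J} (le : C -> C -> Prop) (D : J -> C -> Prop) c0 :
  (forall c, le c c) -> (forall a b c, le a b -> le b c -> le a c) ->
  (forall j c, exists2 d, le d c & D j d) ->
  exists s : nat -> C, [/\ s 0 = c0, forall i j, i <= j -> le (s j) (s i) & forall j, exists n, D j (s n)].
Proof.
move=> refl trans dense.
have /choice[nx hnx] : forall x : J * C, exists d, le d x.2 /\ D x.1 d.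
  by move=> [j c]; have [d] := dense j c; exists d.
pose s := fix s n := if n is k.+1 then nx (@dc _ cJ k, s k) else c0.
exists s; split=> // [i j|j]; last first.
  by exists (ec j).+1; have [_] := hnx (dc (ec j), s (ec j)); rewrite /= dcK.
elim: j => [|j IH]; first by rewrite leqn0 => /eqP->.
rewrite leq_eqVlt => /orP[/eqP-> //|/IH h].
by apply: trans h; have [] := hnx (dc j, s j).
Qed.

Lemma string_limit (s : nat -> seq nat) :
  (forall i j, i <= j -> prefix (s i) (s j)) -> (forall n, exists k, n <= size (s k)) ->
  exists f, forall k, s k = mkseq f (size (s k)).
Proof.
move=> mono unb; have /choice[k hk] : forall n, exists k, n < size (s k) by move=> n; apply: unb.
have agree i j n : n < size (s i) -> n < size (s j) -> nth 0 (s i) n = nth 0 (s j) n.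
  wlog hij : i j / i <= j.
    by move=> H hi hj; case: (leqP i j) => [/H|/ltnW/H] -> //.
  by move=> hi hj; have /prefixP[u ->] := mono _ _ hij; rewrite nth_cat hi.
exists (fun n => nth 0 (s (k n)) n) => j.
apply: (@eq_from_nth _ 0) => [|n hn]; first by rewrite size_mkseq.
by rewrite nth_mkseq //; apply: agree.
Qed.

Section Good.
Variable S : nat -> Prop.

Definition outside m m' := forall x, m <= x <= m' -> ~ S x.
Definition inside m m' := forall x, m <= x <= m' -> S x.

Definition good (O : nat -> nat) :=
  (forall Q : nat * nat -> Prop, S1 O (fun t _ => Q t) ->
     (forall m, exists m', Q (m, m')) -> exists m m', Q (m, m') /\ outside m m') /\
  (forall Q : nat * nat -> Prop, S2 O (fun t _ => Q t) ->
     (forall m, exists m', Q (m, m')) -> exists m m', Q (m, m') /\ inside m m').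

Lemma good_reads O O' : reads O O' -> good O -> good O'.
Proof.
move=> h [h1 h2]; split=> Q hQ; [apply: h1|apply: h2]; first exact: S1_reads hQ.
exact: S2_reads hQ.
Qed.

(** Universal relations represent every Sigma_1 relation, and every Sigma_2 relation as the
    projection of a complement, so two countable lists of requirements suffice. *)
Lemma goodI O :
  (forall r, (forall m : nat, exists m' : nat, univ r (m, m') O) -> exists m m' : nat, univ r (m, m') O /\ outside m m') ->
  (forall r, (forall m : nat, exists m' a : nat, ~ univ r ((m, m'), a) O) ->
     exists m m' a : nat, ~ univ r ((m, m'), a) O /\ inside m m') ->
  good O.
Proof.
move=> h1 h2; split=> Q.
  move=> /S1_universal[r hr] tot.
  have [|m [m' [hU ho]]] := h1 r.
    by move=> m; have [m' /hr hm] := tot m; exists m'.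
  by exists m, m'; split=> //; apply/hr.
move=> [N [hN e]] tot.
have /S1_universal[r hr] : S1 O (fun t _ => N t (fun => 0)).
  by apply: (@S1_at _ _ O O (fun => 0)) hN; [apply: reads_refl|rewrite /reads; s1].
have eQ t : Q t <-> exists a : nat, ~ univ r (t, a) O.
  by rewrite (e t (fun => 0)); split=> -[a ha]; exists a => hh; apply: ha; apply/hr.
have [|m [m' [a [hU ho]]]] := h2 r.
  by move=> m; have [m' /eQ [a ha]] := tot m; exists m', a.
by exists m, m'; split=> //; apply/eQ; exists a.
Qed.

End Good.

(** * The initial oracle *)

(* The numbers in [plock] must not occur beyond [pstr]; those in [pkeep] must never be locked,
   hence occur infinitely often in a generic sequence. *)
Record promise := Promise {
  pstr : seq nat; plock : seq nat; pkeep : seq nat;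
  pdisj : forall x, x \in plock -> x \notin pkeep }.

Definition ple (d c : promise) :=
  [/\ prefix (pstr c) (pstr d), {subset plock c <= plock d}, {subset pkeep c <= pkeep d}
    & forall n, size (pstr c) <= n < size (pstr d) -> nth 0 (pstr d) n \notin plock c].

Lemma ple_refl c : ple c c.
Proof. by split=> //; [exact: prefix_refl|lia]. Qed.

Lemma prefix_nth (s s' : seq nat) n : prefix s s' -> n < size s -> nth 0 s' n = nth 0 s n.
Proof. by move=> /prefixP[u ->] h; rewrite nth_cat h. Qed.

Lemma ple_trans a b c : ple a b -> ple b c -> ple a c.
Proof.
move=> [p1 l1 k1 n1] [p2 l2 k2 n2]; split.
- exact: prefix_trans p2 p1.
- by move=> x /l2/l1.
- by move=> x /k2/k1.
move=> n /andP[h1 h2]; have [h|h] := ltnP n (size (pstr b)).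
  by rewrite (prefix_nth p1 h); apply: n2; rewrite h1.
by have := n1 n; rewrite h h2 => /(_ isT); apply: contra => /l2.
Qed.

Definition interval m m' := iota m (m'.+1 - m).

Lemma mem_interval m m' x : (x \in interval m m') = (m <= x <= m').
Proof. rewrite mem_iota; apply/idP/idP; lia. Qed.

Definition above (s : seq nat) := (\max_(x <- s) x).+1.

Lemma aboveP s x : x \in s -> x < above s.
Proof. by move=> h; rewrite ltnS; apply: (leq_bigmax_seq x). Qed.

(** Only the string of [d] is retained. The locks that [d] added are dropped, so numbers from [m] on
    can be kept, and a Sigma_1 event seen on the string survives. *)
Lemma keep_more (c d : promise) m m' : ple d c -> (forall x, x \in plock c -> x < m) ->
  exists e, [/\ ple e c, pstr e = pstr d & {subset interval m m' <= pkeep e}].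
Proof.
move=> [p l k n] hm.
have disj x : x \in plock c -> x \notin pkeep c ++ interval m m'.
  by move=> h; rewrite mem_cat mem_interval negb_or pdisj //=; have := hm x h; lia.
exists (@Promise (pstr d) (plock c) _ disj); split=> //=.
  by split=> //= x hx; rewrite mem_cat hx.
by move=> x hx; rewrite mem_cat hx orbT.
Qed.

(** The locks of [d] stay and the keeps it added are dropped. [e] need not extend [d], but every
    string reachable from [e] is reachable from [d], so Pi_1 facts forced by [d] remain forced. *)
Lemma lock_more (c d : promise) m m' : ple d c -> (forall x, x \in pkeep c -> x < m) ->
  exists e, [/\ ple e c, {subset interval m m' <= plock e} &
    forall f, ple f e -> exists2 g, ple g d & pstr g = pstr f].
Proof.
move=> [p l k n] hm.
have disj x : x \in plock d ++ interval m m' -> x \notin pkeep c.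
  rewrite mem_cat mem_interval => /orP[/pdisj|h]; first by apply: contra => /k.
  by apply/negP => /hm; lia.
exists (@Promise (pstr d) _ _ disj); split=> /=.
- by split=> //= x hx; rewrite mem_cat l.
- by move=> x hx; rewrite mem_cat hx orbT.
move=> f [fp fl fk fn]; exists (@Promise (pstr f) (plock d) (pkeep d) (@pdisj d)) => //.
split=> //= i hi; apply: contra (fn i hi) => /= h; by rewrite mem_cat h.
Qed.

Lemma extend_string (c : promise) v : v \notin plock c ->
  exists2 d, ple d c & pstr d = rcons (pstr c) v.
Proof.
move=> hv; exists (@Promise (rcons (pstr c) v) (plock c) (pkeep c) (@pdisj c)) => //.
split=> //=; first exact: prefix_rcons.
move=> n; rewrite size_rcons ltnS -eqn_leq => /eqP<-.
by rewrite nth_rcons ltnn eqxx.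
Qed.

Lemma extend_long (c : promise) n : exists2 d, ple d c & n <= size (pstr d).
Proof.
elim: n => [|n [d hd hn]]; first by exists c => //; apply: ple_refl.
have [|e he hs] := @extend_string d (above (plock d)).
  by apply/negP => /aboveP; rewrite ltnn.
by exists e; [apply: ple_trans he hd|rewrite hs size_rcons].
Qed.

(** Tag 0 makes the sequence infinite, tag 1 makes a number that is never locked recur, tags 2 and 3
    are the two halves of goodness (success, or a forced failure of totality), and the other tags
    decide the universal relation. *)
Definition pdense (j : nat * (nat * nat * nat) * nat) (c : promise) : Prop :=
  let: (tag, (m, m', a), r) := j in
  match tag with
  | 0 => m <= size (pstr c)
  | 1 => m \in plock c \/ exists b, m' <= b < size (pstr c) /\ nth 0 (pstr c) b = m
  | 2 => (exists m m', seq_univ r (m, m') (pstr c) /\ {subset interval m m' <= pkeep c}) \/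
         (exists m : nat, forall d, ple d c -> forall m' : nat, ~ seq_univ r (m, m') (pstr d))
  | 3 => (exists m m' a : nat, {subset interval m m' <= plock c} /\
            forall d, ple d c -> ~ seq_univ r ((m, m'), a) (pstr d)) \/
         (exists m : nat, forall d, ple d c -> forall m' a : nat,
            exists2 e, ple e d & seq_univ r ((m, m'), a) (pstr e))
  | _ => seq_univ r ((m, m'), a) (pstr c) \/ forall d, ple d c -> ~ seq_univ r ((m, m'), a) (pstr d)
  end.

Lemma pdenseP j c : exists2 d, ple d c & pdense j d.
Proof.
case: j => -[tag [[m m'] a]] r; rewrite /pdense.
case: tag => [|[|[|[|_]]]].
- by have [d hd hs] := extend_long c m; exists d.
- case: (boolP (m \in plock c)) => h; first by exists c; [apply: ple_refl|left].
  have [d hd hs] := extend_long c m'.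
  case: (boolP (m \in plock d)) => h'; first by exists d => //; left.
  have [e he es] := extend_string h'.
  exists e; first exact: ple_trans he hd.
  by right; exists (size (pstr d)); rewrite es size_rcons nth_rcons ltnn eqxx ltnSn hs.
- pose M := above (plock c).
  case: (pselect (exists d (m' : nat), ple d c /\ seq_univ r (M, m') (pstr d))) => [[d [k [hd hU]]]|hn].
    have [e [he es hk]] := @keep_more c d M k hd (@aboveP _).
    by exists e => //; left; exists M, k; rewrite es.
  exists c; first exact: ple_refl.
  by right; exists M => d hd k hU; apply: hn; exists d, k.
- pose M := above (pkeep c).
  case: (pselect (exists d (m' a : nat), ple d c /\ forall e, ple e d -> ~ seq_univ r ((M, m'), a) (pstr e))).
    move=> [d [k [b [hd hU]]]].
    have [e [he hk ef]] := @lock_more c d M k hd (@aboveP _).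
    exists e => //; left; exists M, k, b; split=> // f /ef[g hg <-].
    exact: hU.
  move=> hn; exists c; first exact: ple_refl.
  right; exists M => d hd k b; apply: contrapT => he; apply: hn; exists d, k, b; split=> // e hed hU.
  by apply: he; exists e.
case: (pselect (exists2 d, ple d c & seq_univ r ((m, m'), a) (pstr d))) => [[d hd hU]|hn].
  by exists d => //; left.
exists c; first exact: ple_refl.
by right=> d hd hU; apply: hn; exists d.
Qed.

Lemma good_oracle : exists (O : nat -> nat),
  good (fun x => exists a, forall b, a < b -> O b <> x) O.
Proof.
have [c [c0 mono hD]] := generic_sequence (@Promise [::] [::] [::] (fun _ _ => isT))
   ple_refl ple_trans pdenseP.
have pre i j : i <= j -> prefix (pstr (c i)) (pstr (c j)) by move=> /mono[].
have [|O hO] := @string_limit (fun n => pstr (c n)) pre.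
  by move=> n; have [k hk] := hD (0, (n, 0, 0), 0); exists k.
pose S x := exists a, forall b, a < b -> O b <> x.
have long n : exists k, n <= size (pstr (c k)) by have [k hk] := hD (0, (n, 0, 0), 0); exists k.
have nthO k n : n < size (pstr (c k)) -> nth 0 (pstr (c k)) n = O n.
  by move=> hn; rewrite hO nth_mkseq.
have lockS k x : x \in plock (c k) -> S x.
  move=> hx; exists (size (pstr (c k))) => b hb hbx.
  have [j hj] := long b.+1.
  have hkj := leq_maxl k j; have [_ _ _ /(_ b)] := mono _ _ hkj.
  have hb' : b < size (pstr (c (maxn k j))).
    by apply: leq_trans hj _; apply: size_prefix; apply: pre; apply: leq_maxr.
  by rewrite ltnW // hb' nthO // hbx hx => /(_ isT).
(* A kept number is locked at no stage, so tag 1 gives it an occurrence beyond every bound. *)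
have keepS k x : x \in pkeep (c k) -> ~ S x.
  move=> hx [a ha]; have [j [hl|[b [/andP[hb1 hb2] hb]]]] := hD (1, (x, a.+1, 0), 0).
    have [_ l1 _ _] := mono _ _ (leq_maxl j k).
    have [_ _ k1 _] := mono _ _ (leq_maxr j k).
    by have := pdisj (l1 _ hl); rewrite k1.
  by apply: (ha b) => //; rewrite -(nthO j).
have UO T (cT : coded T) r (t : T) : univ r t O <-> exists k, seq_univ r t (pstr (c k)).
  rewrite univ_seq; split=> [[l hl]|[k]]; last by rewrite hO; exists (size (pstr (c k))).
  have [k hk] := long l; exists k; apply: seq_univ_prefix hl; rewrite hO.
  by rewrite prefixE size_mkseq take_mkseq_le.
exists O; apply: (@goodI S) => r tot.
  have [k [[m [m' [hU hs]]]|[m hn]]] := hD (2, (0, 0, 0), r).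
    exists m, m'; split; first by apply/UO; exists k.
    by move=> x hx; apply: keepS; apply: hs; rewrite mem_interval.
  have [m' /UO[j hj]] := tot m.
  case: (hn _ (mono _ _ (leq_maxl k j)) m').
  by apply: seq_univ_prefix hj; apply: pre; apply: leq_maxr.
have [k [[m [m' [a [hs hU]]]]|[m hn]]] := hD (3, (0, 0, 0), r).
  exists m, m', a; split; last by move=> x hx; apply: lockS; apply: hs; rewrite mem_interval.
  move=> /UO[j hj]; case: (hU _ (mono _ _ (leq_maxl k j))).
  by apply: seq_univ_prefix hj; apply: pre; apply: leq_maxr.
have [m' [a hnU]] := tot m.
(* The relation fails on [O], so the deciding condition excludes it below, against the density of
   conditions where it holds. *)
have [j [hU|hU]] := hD (4, (m, m', a), r); first by case: hnU; apply/UO; exists j.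
have [e he hUe] := hn _ (mono _ _ (leq_maxl k j)) m' a.
by case: (hU e) => //; apply: ple_trans he (mono _ _ (leq_maxr _ _)).
Qed.

(** * Good members of closed classes *)

Lemma S1_univ_join T (cT : coded T) O r : S1 O (fun (t : T) h => univ r t (join O h)).
Proof.
apply: (@S1_subst _ _ O O _ (fun _ h => join O h) (reads_refl O)); last exact: S1_univ.
apply: (@S1_ext _ _ _ (fun x h => exists v w, O x.1.2 = v /\ h x.1.2 = w /\ npair v w = x.2)); last by s1.
move=> x h; split=> [[v [w [<- [<- <-]]]] //|<-]; by exists (O x.1.2), (h x.1.2).
Qed.

Section Basis.
Variables (S : nat -> Prop) (O : nat -> nat) (K : nat).
Hypothesis gO : good S O.

(** Pi_1 classes relative to [O] that meet the compact space of functions below [K]. They are the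
    forcing conditions for the basis theorem. *)
Record closed_class := ClosedClass {
  cls :> (nat -> nat) -> Prop;
  clsS1 : S1 O (fun (_ : nat) h => ~ cls h);
  cls_ex : exists2 h, forall x, h x < K & cls h }.

Definition cle (D C : closed_class) := forall h, (forall x, h x < K) -> D h -> C h.

Lemma cls_restrict (C : closed_class) (P : (nat -> nat) -> Prop) :
  S1 O (fun (_ : nat) h => ~ P h) -> (exists2 h, forall x, h x < K & C h /\ P h) ->
  exists D, cle D C /\ forall h, D h -> P h.
Proof.
move=> hP hex.
have hD : S1 O (fun (_ : nat) h => ~ (C h /\ P h)).
  apply: S1_ext (S1_or (clsS1 C) hP) => _ h.
  by split; [tauto|move/not_andP].
by exists (ClosedClass hD hex); split=> [h _ []|h []].
Qed.

Definition cdense (j : nat * nat) (C : closed_class) : Prop :=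
  let: (tag, r) := j in
  match tag with
  | 0 => exists s, forall h, (forall x, h x < K) -> C h -> mkseq h r = s
  | 1 => (exists m m' : nat, outside S m m' /\ forall h, (forall x, h x < K) -> C h ->
            exists2 m'', m'' <= m' & univ r (m, m'') (join O h)) \/
         (exists m : nat, forall h, (forall x, h x < K) -> C h -> forall m' : nat, ~ univ r (m, m') (join O h))
  | _ => (exists m m' a : nat, inside S m m' /\ forall h, (forall x, h x < K) -> C h -> ~ univ r ((m, m'), a) (join O h)) \/
         (exists m : nat, forall h, (forall x, h x < K) -> C h -> forall m' a : nat, univ r ((m, m'), a) (join O h))
  end.

Lemma cdense0 r C : exists2 D, cle D C & cdense (0, r) D.
Proof.
have [h hK hC] := cls_ex C.
have [||D [hD hP]] := @cls_restrict C (fun g => is_mkseq g r (mkseq h r)).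
- apply: (@S1_ext _ _ _ (fun _ g => exists i v, g i = v /\ (i < r /\ v <> nth 0 (mkseq h r) i))); last by s1.
  move=> _ g; split=> [[i [v [<- [hi hv]]]] [_ hg]|hg]; first by apply: hv; apply: hg.
  apply: contrapT => hn; apply: hg; split; first by rewrite size_mkseq.
  by move=> i hi; apply: contrapT => hv; apply: hn; exists i, (g i).
- by exists h => //; split=> //; apply: is_mkseq_exact.
exists D => //; exists (mkseq h r) => g hg /hP /is_mkseqP hs.
by apply/esym.
Qed.

(** If some member of the class has an empty row [m], the class shrinks to such members. Otherwise
    compactness bounds an entry of each row over the whole class, and goodness of [O] applies to the
    bounds; initial parts of an interval outside [S] are outside [S]. *)
Lemma cdense1 r C : exists2 D, cle D C & cdense (1, r) D.
Proof.
have hU : S1 O (fun x : nat * nat => fun h => univ r x (join O h)) by apply: S1_univ_join.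
case: (pselect (exists (m : nat) h, [/\ forall x, h x < K, C h & forall m' : nat, ~ univ r (m, m') (join O h)])).
  move=> [m [h [hK hC hn]]].
  have [||D [hD hP]] := @cls_restrict C (fun g => forall m' : nat, ~ univ r (m, m') (join O g)).
  - apply: (@S1_ext _ _ _ (fun _ g => exists m' : nat, univ r (m, m') (join O g))).
      move=> _ g; split=> [[m' hm] /(_ m') //|hg].
      by apply: contrapT => hm; apply: hg => m' hm'; apply: hm; exists m'.
    by apply: S1_ex; apply: (S1_comp hU); deff.
  - by exists h.
  by exists D => //; right; exists m => g _ /hP.
move=> hn.
pose (N := fun (x : nat * nat) (h : nat -> nat) => ~ C h \/ exists m'' : nat, m'' <= x.2 /\ univ r (x.1, m'') (join O h)).
have hN : S1 O N.
  apply: S1_or; first by apply: (S1_comp (clsS1 C) (f := fun=> 0)); deff.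
  apply: S1_ex; apply: S1_and; first by s1.
  by apply: (S1_comp hU); deff.
have [||m [m' [hm ho]]] := gO.1 (fun x => forall h, (forall y, h y < K) -> N x h).
- by apply: S1_compact hN _; deff.
- move=> m; apply: (compact_union hN) => [m1 m2 h hm [hc|[k [hk1 hk2]]]|h hh].
  + by left.
  + by right; exists k; split=> //; apply: leq_trans hm.
  case: (pselect (C h)) => hC; last by exists 0; left.
  case: (pselect (exists m' : nat, univ r (m, m') (join O h))) => [[m' hm']|hm].
    by exists m'; right; exists m'.
  by case: hn; exists m, h; split=> // m' hm'; apply: hm; exists m'.
exists C => //; left; exists m, m'; split=> // h hh hC.
by have [//|[k [h1 h2]]] := hm h hh; exists k.
Qed.

(** By compactness it is Sigma_2 in [O] that some member refutes the universal relation at [(m, m')]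
    for some [a]. If this is total, goodness of [O] gives an interval inside [S] and the class
    shrinks to the members refuting it there; otherwise some row is full for all members. *)
Lemma cdense2 r C : exists2 D, cle D C & cdense (2, r) D.
Proof.
have hU : S1 O (fun x : nat * nat * nat => fun h => univ r x (join O h)) by apply: S1_univ_join.
pose (N := fun (x : nat * nat * nat) (h : nat -> nat) => ~ C h \/ univ r x (join O h)).
have hN : S1 O N.
  by apply: S1_or => //; apply: (S1_comp (clsS1 C) (f := fun=> 0)); deff.
case: (pselect (forall m, exists m' a : nat, ~ (forall h, (forall x, h x < K) -> N (m, m', a) h))) => tot.
  have [||m [m' [[a ha] hi]]] := gO.2 (fun x => exists a, ~ (forall h, (forall y, h y < K) -> N (x, a) h)).
  - exists (fun x _ => forall h, (forall y, h y < K) -> N x h); split=> //.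
    by apply: S1_compact hN _; deff.
  - by move=> m; have [m' [a ha]] := tot m; exists m', a.
  have [||D [hD hP]] := @cls_restrict C (fun g => ~ univ r (m, m', a) (join O g)).
  - apply: (@S1_ext _ _ _ (fun (_ : nat) g => univ r (m, m', a) (join O g))).
      by move=> _ g; split=> [h1 h2|/contrapT //]; exact: h2 h1.
    by apply: (S1_comp hU (f := fun=> (m, m', a))); deff.
  - move/existsNP: ha => [h /not_implyP[hK /not_orP[/contrapT hC hnU]]].
    by exists h.
  by exists D => //; left; exists m, m', a; split=> // g _ /hP.
exists C => //; right; move/existsNP: tot => [m hm]; exists m => h hh hC m' a.
apply: contrapT => hnU; apply: hm; exists m', a => /(_ h hh)[] //.
Qed.

Lemma cdenseP j C : exists2 D, cle D C & cdense j D.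
Proof.
case: j => -[|[|n]] r; [exact: cdense0|exact: cdense1|].
by have [D h1 h2] := cdense2 r C; exists D.
Qed.

Lemma good_basis (C : (nat -> nat) -> Prop) :
  S1 O (fun (_ : nat) h => ~ C h) -> (exists2 h, forall x, h x < K & C h) ->
  exists h, [/\ forall x, h x < K, C h & good S (join O h)].
Proof.
move=> hC hex.
have [||c [c0 mono hD]] := generic_sequence (ClosedClass hC hex) _ _ cdenseP.
- by move=> c h.
- by move=> x y z h1 h2 h hK hx; apply: h2 => //; apply: h1.
have /choice[g hg] : forall n, exists h, (forall x, h x < K) /\ c n h.
  by move=> n; have [h] := cls_ex (c n); exists h.
have /choice[k hk] : forall n, exists k, cdense (0, n.+1) (c k) by move=> n; apply: hD.
have gc i j : i <= j -> c i (g j) by move=> hij; apply: (mono _ _ hij); apply (hg j).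
pose h n := g (k n) n.
have agree n j : k n <= j -> g j n = h n.
  move=> hj; have [s hs] := hk n; have [hK _] := hg j; have [hK' hc'] := hg (k n).
  have := hs _ hK (gc _ _ hj); rewrite -(hs _ hK' hc') => /(congr1 (fun s => nth 0 s n)).
  by rewrite !nth_mkseq.
have approx n l : exists2 j, n <= j & mkseq (g j) l = mkseq h l.
  exists (maxn n (\max_(i < l) k i)); first exact: leq_maxl.
  apply: (@eq_from_nth _ 0); rewrite !size_mkseq // => i hi; rewrite !nth_mkseq //.
  by apply: agree; apply: leq_trans (leq_maxr _ _); apply: (leq_bigmax (Ordinal hi)).
have hK x : h x < K by have [hh _] := hg (k x); apply: hh.
(* Membership in [c n] fails only through a finite segment, and segments of the limit are shared
   with members of [c n]. *)
have hc n : c n h.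
  apply: contrapT; have [R [_ e]] := clsS1 (c n); move=> /(e 0)[l hl].
  have [j hj hjl] := approx n l.
  have : ~ c n (g j) by apply/(e 0); exists l; rewrite hjl.
  by apply; apply: gc.
exists h; split=> //; first by have := hc 0; rewrite c0.
apply: goodI => r tot.
  have [n [[m [m' [ho hU]]]|[m hn]]] := hD (1, r).
    have [k' hk' hU'] := hU h hK (hc n); exists m, k'; split=> // x hx; apply: ho; lia.
  by have [m' hm'] := tot m; case: (hn h hK (hc n) m').
have [n [[m [m' [a [hi hU]]]]|[m hn]]] := hD (2, r).
  by exists m, m', a; split=> //; apply: hU.
by have [m' [a ha]] := tot m; case: ha; apply: hn.
Qed.

End Basis.

(** * Ideals generated by closed classes *)

(** [univ] is [S1] only for one index at a time; this glues finitely many indices into a relation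
    that is uniform in [i < k]. *)
Lemma S1_family T (cT : coded T) O k (P : nat -> T -> (nat -> nat) -> Prop) :
  (forall i, S1 O (P i)) ->
  S1 O (fun x : nat * T => fun h => x.1 < k /\ P x.1 x.2 h).
Proof.
move=> hP; elim: k => [|k IH].
  by apply: S1_ext (S1_def O (Def_prop _ False)) => x h; split=> // -[].
apply: (@S1_ext _ _ _ (fun x h => (x.1 < k /\ P x.1 x.2 h) \/ (x.1 = k /\ P k x.2 h))).
  move=> [i t] h /=; have -> : (i < k.+1) = (i == k) || (i < k) by rewrite ltnS leq_eqVlt.
  split=> [[[h1 h2]|[-> h2]]|[/orP[/eqP->|h1] h2]]; last by left.
  - by rewrite h1 orbT.
  - by rewrite eqxx.
  by right.
apply: S1_or => //; apply: S1_and; first by s1.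
by apply: (S1_comp (hP k)); deff.
Qed.

Definition join_univ (Z : nat -> nat) (r : nat) (t : nat * nat * nat) (s : seq nat) : Prop :=
  seq_univ r t (mkseq (join Z (nth 0 s)) (size s)).

Lemma join_univ_prefix Z r t s s' : prefix s s' -> join_univ Z r t s -> join_univ Z r t s'.
Proof.
move=> hs; apply: seq_univ_prefix; rewrite prefixE size_mkseq take_mkseq_le ?size_prefix //.
apply/eqP/eq_in_map => i; rewrite mem_iota => /andP[_ hi].
by rewrite /join; case/prefixP: hs => u ->; rewrite nth_cat hi.
Qed.

Lemma univ_join Z r t f : univ r t (join Z f) <-> exists l, join_univ Z r t (mkseq f l).
Proof.
rewrite univ_seq; suff e l : mkseq (join Z f) l = mkseq (join Z (nth 0 (mkseq f l))) (size (mkseq f l)).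
  by split=> -[l hl]; exists l; [rewrite /join_univ -e|rewrite e].
rewrite size_mkseq; apply/eq_in_map => i; rewrite mem_iota => /andP[_ hi].
by rewrite /join nth_mkseq.
Qed.

Section join_univ.
Variables (Z O : nat -> nat) (r : nat).
Hypothesis hZ : reads O Z.

Lemma S1_join_string T (cT : coded T) (s : T -> seq nat) : Deff s ->
  S1 O (fun x : T * nat * nat => fun _ => join Z (nth 0 (s x.1.1)) x.1.2 = x.2).
Proof.
move=> hs; apply: (@S1_ext _ _ _ (fun x _ => exists v, Z x.1.2 = v /\ npair v (nth 0 (s x.1.1) x.1.2) = x.2)).
  by move=> x _; split=> [[v [<- <-]]|<-] //; exists (Z x.1.2).
have hs' : Deff (fun x : T * nat * nat * nat => s x.1.1.1) by apply: (Deff_comp hs); deff.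
apply: S1_ex; apply: S1_and; last by s1.
by apply: (@S1_comp _ _ _ _ _ _ (fun x : T * nat * nat * nat => (x.1.1.2, x.2)) hZ); deff.
Qed.

Lemma S1_join_univ : S1 O (fun x : (nat * nat * nat) * seq nat => fun _ => join_univ Z r x.1 x.2).
Proof.
apply: (@S1_ext _ _ _ (fun x _ => exists s, is_mkseq (join Z (nth 0 x.2)) (size x.2) s /\ seq_univ r x.1 s)).
  move=> x _; split=> [[s [/is_mkseqP->]] //|h].
  by exists (mkseq (join Z (nth 0 x.2)) (size x.2)); split=> //; apply: is_mkseq_exact.
apply: S1_ex; apply: S1_and.
  apply: (@S1_mkseq _ _ _ (fun x _ => join Z (nth 0 x.1.2))); [|deff..].
  by apply: (@S1_join_string _ _ (fun x => x.1.2)); deff.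
by apply: S1_def; apply: Def_ex; apply: (Def_comp (Def_den _ r)); deff.
Qed.
End join_univ.

Definition piece (X h : nat -> nat) (j : nat) : nat -> nat :=
  fun x => (0 < X x) && (h x == j).

Lemma piece_gt0 X h j x : (0 < piece X h j x) = (0 < X x) && (h x == j).
Proof. by rewrite /piece; case: (_ && _). Qed.

Section Ideal.
Variables (D : nat -> Prop) (C : nat -> (nat -> nat) -> Prop).
Hypothesis Cmono : forall w (h h' : nat -> nat), (forall x, 0 < h' x -> 0 < h x) -> C w h -> C w h'.

(** A set is the positive part of a function. This is the ideal generated by the sets [Y] with
    [C w Y] for some [w] in [D]. *)
Inductive ideal : (nat -> nat) -> Prop :=
| ideal0 X : (forall x, X x = 0) -> ideal X
| idealU w Y X X' : D w -> C w Y -> ideal X' -> (forall x, 0 < X x -> 0 < Y x \/ 0 < X' x) -> ideal X.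

Lemma idealD X Y V : ideal X -> ideal Y -> (forall x, 0 < V x -> 0 < X x \/ 0 < Y x) -> ideal V.
Proof.
move=> hX hY; elim: hX V => [X0 h0|w Y0 X0 X' hw hC hX' IH h0] V hV.
  elim: hY V hV => [Y1 h1|w Y1 X1 X' hw hC hX' _ h1] V hV.
    by apply: ideal0 => x; apply/eqP; rewrite eqn0Ngt; apply/negP => /hV; rewrite h0 h1 => -[].
  by apply: (idealU hw hC hX') => x /hV; rewrite h0 => -[//|/h1].
apply: (idealU hw hC (IH (fun x => (0 < X' x) || (0 < Y x) : nat) _)) => x.
  by case: (0 < X' x) => /=; [left|case: (0 < Y x); [right|]].
by case/hV => [/h0[h|h]|h]; [left|right; rewrite h|right; rewrite h orbT].
Qed.

Lemma idealS X Y : ideal X -> (forall x, 0 < Y x -> 0 < X x) -> ideal Y.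
Proof. by move=> hX h; apply: (idealD hX hX) => x /h; left. Qed.

Lemma ideal1 w Y : D w -> C w Y -> ideal Y.
Proof. by move=> hw hC; apply: (idealU hw hC (@ideal0 (fun=> 0) _)) => //; left. Qed.

Lemma ideal_pieces n X h : (forall x, 0 < X x -> h x < n) ->
  (forall j, j < n -> ideal (piece X h j)) -> ideal X.
Proof.
elim: n X => [|n IH] X hX hp.
  by apply: ideal0 => x; apply/eqP; rewrite eqn0Ngt; apply/negP => /hX.
apply: (idealD (hp n (ltnSn n)) (IH (fun x => (0 < X x) && (h x < n) : nat) _ _)) => [x|j hj|x hx].
- by rewrite lt0b => /andP[].
- apply: idealS (hp j (ltnW hj)) _ => x; rewrite !piece_gt0 lt0b.
  by move=> /andP[/andP[-> _] ->].
by rewrite piece_gt0 lt0b hx /=; have := hX x hx; rewrite ltnS leq_eqVlt => /orP.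
Qed.

(** Each point goes to the first generator that contains it, and [Cmono] passes from the generator
    to the piece. A cover thus becomes a bounded function, to which compactness and the basis
    theorem apply. *)
Lemma ideal_partition X : ideal X -> exists ws h,
  [/\ forall j, j < size ws -> D (nth 0 ws j), forall x, 0 < X x -> h x < size ws
    & forall j, j < size ws -> C (nth 0 ws j) (piece X h j)].
Proof.
elim=> [X0 h0|w Y X0 X' hw hC _ [ws [h [h1 h2 h3]]] hX].
  by exists [::], (fun=> 0); split=> // x; rewrite h0.
exists (w :: ws), (fun x => if 0 < Y x then 0 else (h x).+1); split=> [[|j] //|x hx|[|j] hj] /=.
- exact: h1.
- by case: ifP => // hY; rewrite ltnS; apply: h2; case: (hX x hx) => //; rewrite hY.
- by apply: Cmono hC => x; rewrite piece_gt0; case: ifP => //; rewrite andbF.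
apply: Cmono (h3 j hj) => x; rewrite !piece_gt0; case: ifP => hY; first by rewrite andbF.
by rewrite eqSS => /andP[/hX[|->]]; rewrite ?hY.
Qed.
End Ideal.

(** * Mathias forcing with ideals *)

(** Strings extending [s] whose new elements lie in [V]. Disjunctions replace implications to keep
    the formula positive in [V], so it is Sigma_1 or Sigma_2 when [V] is. *)
Definition ext (s : seq nat) (V : nat -> Prop) (t : seq nat) : Prop :=
  size s <= size t /\ ((forall n, n < size s -> nth 0 t n = nth 0 s n) /\
  forall n, n < size t -> n < size s \/ (nth 0 t n = 0 \/ (nth 0 t n = 1 /\ V n))).

Lemma ext_refl s V : ext s V s.
Proof. by split=> //; split=> // n ->; left. Qed.

Lemma ext_trans s V t V' u : ext s V t -> ext t V' u -> (forall n, V' n -> V n) -> ext s V u.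
Proof.
move=> [a1 [a2 a3]] [b1 [b2 b3]] hV; split; [lia|split=> n hn].
  by rewrite b2 ?a2 //; lia.
have [h|[h|[h /hV hv]]] := b3 n hn; [|by right; left|by right; right].
by rewrite b2 //; apply: a3.
Qed.

Lemma ext_mono s (V V' : nat -> Prop) t : (forall n, V n -> V' n) -> ext s V t -> ext s V' t.
Proof. by move=> hV h; apply: ext_trans (ext_refl s V') h hV. Qed.

Lemma S1_extends T (cT : coded T) O (s t : T -> seq nat) (V : T -> (nat -> nat) -> nat -> Prop) :
  Deff s -> Deff t -> S1 O (fun x : T * nat => fun h => V x.1 h x.2) ->
  S1 O (fun x h => ext (s x) (V x h) (t x)).
Proof.
move=> hs ht hV.
have hs' : Deff (fun x : T * nat => s x.1) by apply: (Deff_comp hs); deff.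
have ht' : Deff (fun x : T * nat => t x.1) by apply: (Deff_comp ht); deff.
by rewrite /ext; s1.
Qed.

Lemma S2_extends T (cT : coded T) O (s t : T -> seq nat) (V : T -> nat -> Prop) :
  Deff s -> Deff t -> S2 O (fun x : T * nat => fun _ => V x.1 x.2) ->
  S2 O (fun x _ => ext (s x) (V x) (t x)).
Proof.
move=> hs ht hV.
have hs' : Deff (fun x : T * nat => s x.1) by apply: (Deff_comp hs); deff.
have ht' : Deff (fun x : T * nat => t x.1) by apply: (Deff_comp ht); deff.
have S2d T' (cT' : coded T') (P : T' -> Prop) : Def P -> S2 O (fun x _ => P x).
  by move=> hP; apply: S2_S1; apply: S1_def.
apply: S2_and; first by apply: S2d; def.
apply: S2_and; first by apply: S2d; def.
apply: S2_ball => /=; first by deff.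
apply: S2_or; first by apply: S2d; def.
apply: S2_or; first by apply: S2d; def.
apply: S2_and => //; by apply: S2d; def.
Qed.

Lemma reads_S1 T (cT : coded T) O X (a b : T -> nat) :
  reads O X -> Deff a -> Deff b -> S1 O (fun t _ => X (a t) = b t).
Proof.
move=> hX ha hb.
by apply: (@S1_comp _ _ _ _ _ (fun x _ => X x.1 = x.2) (fun t => (a t, b t)) hX); deff.
Qed.

Lemma reads_S1_pos T (cT : coded T) O X (a : T -> nat) :
  reads O X -> Deff a -> S1 O (fun t _ => 0 < X (a t)).
Proof.
move=> hX ha; apply: (@S1_ext _ _ _ (fun t _ => exists v, X (a t) = v /\ 0 < v)).
  by move=> t _; split=> [[v [->]]//|h]; exists (X (a t)).
apply: S1_ex; apply: S1_and; last by s1.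
have ha' : Deff (fun x : T * nat => a x.1) by apply: (Deff_comp ha); deff.
by apply: (reads_S1 hX) => //; deff.
Qed.

Lemma S1_h_pos T (cT : coded T) O (a : T -> nat) :
  Deff a -> S1 O (fun t h => 0 < h (a t)).
Proof.
move=> ha; apply: (@S1_ext _ _ _ (fun t h => exists v, h (a t) = v /\ 0 < v)).
  by move=> t h; split=> [[v [->]]//|hh]; exists (h (a t)).
have ha' : Deff (fun x : T * nat => a x.1) by apply: (Deff_comp ha); deff.
by s1.
Qed.

Lemma S1_piece T (cT : coded T) O X (j : T -> nat) : reads O X -> Deff j ->
  S1 O (fun x : T * nat * nat => fun h => piece X h (j x.1.1) x.1.2 = x.2).
Proof.
move=> hX hj.
apply: (@S1_ext _ _ _ (fun x h => exists v w, X x.1.2 = v /\ (h x.1.2 = w /\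
   ((0 < v /\ (w = j x.1.1 /\ x.2 = 1)) \/ (~ (0 < v /\ w = j x.1.1) /\ x.2 = 0))))).
  move=> [[t n] v] h /=; split=> [[v' [w [<- [<- []]]]]|<-].
  - by move=> [h1 [h2 ->]]; rewrite /piece h1 h2 eqxx.
  - move=> [hn ->]; rewrite /piece; case: (posnP (X n)) => //= hp.
    by case: eqP => // e; case: hn.
  exists (X n), (h n); split=> //; split=> //; rewrite /piece.
  case: (posnP (X n)) => hp /=; first by right; split=> // -[].
  by case: eqP => e; [left|right; split=> // -[]].
have hj' : Deff (fun x : T * nat * nat * nat * nat => j x.1.1.1.1) by apply: (Deff_comp hj); deff.
apply: S1_ex; apply: S1_ex; apply: S1_and; last by s1.
by apply: (reads_S1 hX); deff.
Qed.

Section Forcing.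
Variables (S : nat -> Prop) (Z X0 A : nat -> nat) (k : nat).
Hypotheses (k0 : 0 < k) (Ak : forall x, A x < k).
Hypothesis A2 : S2 Z (fun (x : nat * nat) _ => A x.1 = x.2).

(* [cg] is an initial segment of the union of the sides under construction (side [i] is its
   intersection with [A = i]) and [cX] is the reservoir. The ideal of the sets that are too small to
   be a reservoir is generated by the sets [U] such that [cC w U] for some [w] with [cD w]. *)
Record cond := Cond {
  cg : seq nat; cO : nat -> nat; cX : nat -> nat;
  cD : nat -> Prop; cC : nat -> (nat -> nat) -> Prop;
  cgood : good S cO; cZ : reads cO Z; cXr : reads cO cX;
  cX0 : forall x, 0 < cX x -> 0 < X0 x /\ size cg <= x;
  cD2 : S2 cO (fun w _ => cD w);
  cC1 : S1 cO (fun w h => ~ cC w h);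
  cCm : forall w (h h' : nat -> nat), (forall x, 0 < h' x -> 0 < h x) -> cC w h -> cC w h';
  cfin : forall N, exists2 w, cD w & forall h : nat -> nat, (forall x, 0 < h x -> x < N) -> cC w h;
  cpos : ~ ideal cD cC cX }.

Definition small (c : cond) := ideal (cD c) (cC c).

Definition fle (d c : cond) :=
  [/\ prefix (cg c) (cg d), forall n, size (cg c) <= n < size (cg d) -> 0 < nth 0 (cg d) n -> 0 < cX c n,
      forall x, 0 < cX d x -> 0 < cX c x & forall Y, small c Y -> small d Y].

Lemma fle_refl c : fle c c.
Proof. by split=> //; [exact: prefix_refl|lia]. Qed.

Lemma fle_trans a b c : fle a b -> fle b c -> fle a c.
Proof.
move=> [p1 n1 x1 i1] [p2 n2 x2 i2]; split.
- exact: prefix_trans p2 p1.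
- move=> n /andP[h1 h2]; have [h|h] := ltnP n (size (cg b)).
    by rewrite (prefix_nth p1 h); apply: n2; rewrite h1.
  by move=> hn; apply: x2; apply: n1 hn; rewrite h.
- by move=> x /x1/x2.
by move=> Y /i2/i1.
Qed.

Definition side (g : seq nat) i := mkseq (fun n => (0 < nth 0 g n) && (A n == i) : nat) (size g).

Lemma size_side g i : size (side g i) = size g. Proof. by rewrite size_mkseq. Qed.

Lemma nth_side g i n : n < size g -> nth 0 (side g i) n = (0 < nth 0 g n) && (A n == i).
Proof. by move=> h; rewrite nth_mkseq. Qed.

Definition fresh (c : cond) i n := 0 < cX c n /\ A n = i.

Lemma fle_side d c i : fle d c -> ext (side (cg c) i) (fresh c i) (side (cg d) i).
Proof.
move=> [p n1 x1 _]; have hs := size_prefix p.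
split; [by rewrite !size_side|split=> n; rewrite !size_side => hn].
  by have hn' := leq_trans hn hs; rewrite !nth_side // (prefix_nth p).
rewrite nth_side //; case: (ltnP n (size (cg c))) => h; [by left|right].
case: (posnP (nth 0 (cg d) n)) => hp /=; first by left.
by case: eqP => e; [right; split=> //; split=> //; apply: n1; rewrite ?h|left].
Qed.

Lemma small_fin (c : cond) N (Y : nat -> nat) : (forall x, 0 < Y x -> x < N) -> small c Y.
Proof. by move=> hY; have [w hw hC] := cfin c N; apply: (ideal1 hw); apply: hC. Qed.

Lemma reads_cut O X N : reads O X -> reads O (fun n => if N <= n then X n else 0).
Proof.
move=> hX; apply: (@S1_ext _ _ _ (fun x _ => (N <= x.1 /\ X x.1 = x.2) \/ (~ N <= x.1 /\ x.2 = 0))).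
  move=> [n v] _ /=; case: ifP => h; split.
  - by case=> [[]//|[]].
  - by left.
  - by case=> [[]//|[_ ->]].
  - by move=> <-; right.
apply: S1_or; last by s1.
by apply: S1_and; [s1|exact: hX].
Qed.

(** The new elements of [t] all satisfy [A = i], so adding them changes side [i] alone. The new
    reservoir is cut below [size t], which loses a finite, hence small, set. *)
Lemma refine (c : cond) i t O' X' : ext (side (cg c) i) (fresh c i) t ->
  reads O' (cO c) -> good S O' -> reads O' X' -> (forall x, 0 < X' x -> 0 < cX c x) -> ~ small c X' ->
  exists d, [/\ fle d c, side (cg d) i = t, forall x, 0 < cX d x -> 0 < X' x & cO d = O'].
Proof.
move=> [e1 [e2 e3]] hO gO hX' hsub hpos; rewrite size_side in e1 e2 e3.
pose g := mkseq (fun n => if n < size (cg c) then nth 0 (cg c) n else nth 0 t n) (size t).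
have sg : size g = size t by rewrite size_mkseq.
pose X := fun n => if size t <= n then X' n else 0.
have hX x : 0 < X x -> 0 < X0 x /\ size g <= x.
  by rewrite /X sg; case: ifP => // _ /hsub /(cX0 (c := c))[].
have hp : ~ ideal (cD c) (cC c) X.
  move=> hI; apply: hpos; apply: (idealD hI (@small_fin c (size t) (fun x => (0 < X' x) && (x < size t) : nat) _)).
    by move=> x; rewrite lt0b => /andP[].
  by move=> x hx; rewrite /X; case: (leqP (size t) x) => h; [left|right; rewrite hx].
exists (@Cond g O' X (cD c) (cC c) gO (reads_trans hO (cZ c)) (reads_cut _ hX') hX
   (S2_reads hO (cD2 c)) (S1_reads hO (cC1 c)) (@cCm c) (@cfin c) hp); split=> //=.
- split=> //=.
  + rewrite prefixE; apply/eqP; apply: (@eq_from_nth _ 0) => [|n]; rewrite size_takel ?sg //.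
    by move=> hn; rewrite nth_take // nth_mkseq ?hn //; exact: leq_trans hn e1.
  + move=> n; rewrite sg => /andP[h1 h2]; rewrite nth_mkseq // [n < size (cg c)]ltnNge h1 /=.
    by have [h|[->//|[_ [hv _]] _ //]] := e3 n h2; move: (leq_trans h h1); rewrite ltnn.
  + by move=> x; rewrite /X; case: ifP => // _ /hsub.
- apply: (@eq_from_nth _ 0) => [|n]; rewrite size_side // sg => hn.
  rewrite nth_side ?sg // nth_mkseq //; case: (ltnP n (size (cg c))) => h.
    by rewrite e2 // nth_side.
  have [h'|[->//|[-> [_ ->]]]] := e3 n hn; [lia|by rewrite eqxx].
by move=> x; rewrite /X; case: ifP.
Qed.

Lemma infinite_cX (c : cond) n : exists2 x, n <= x & 0 < cX c x.
Proof.
apply: contrapT => hn; apply: (@cpos c); apply: (@small_fin c n) => x hx.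
by rewrite ltnNge; apply/negP => h; apply: hn; exists x.
Qed.

(** * Meeting one disjunctive requirement *)

Section Requirement.
Variables ty rs : seq nat.

(* Side [i] has to meet a requirement of the first kind (about the open relation coded by
   [nth 0 rs i]) if [nth 0 ty i = 0], and otherwise one of the second kind (about the
   projection of the complement of that relation). *)
Let R i := nth 0 rs i.

Definition win1 (c : cond) i := exists m m' a : nat,
  outside S m m' /\ join_univ Z (R i) (m, m', a) (side (cg c) i).
Definition dead1 (c : cond) i := exists m : nat, forall t,
  ext (side (cg c) i) (fun n => 0 < cX c n) t -> forall m' a : nat, ~ join_univ Z (R i) (m, m', a) t.
Definition win2 (c : cond) i := exists m m' a : nat, inside S m m' /\
  forall t, ext (side (cg c) i) (fun n => 0 < cX c n) t -> ~ join_univ Z (R i) (m, m', a) t.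
(** [v] codes, for each side of the second kind, a claimed pair [(m', a)] at which its relation
    should fail. The event is a success of the first kind or the refutation of a claim. *)
Definition fire (m : nat) (v : seq nat) (c : cond) := exists i, i < k /\
  ((nth 0 ty i = 0 /\ win1 c i) \/
   (nth 0 ty i <> 0 /\ join_univ Z (R i) (m, nfst (nth 0 v i), nsnd (nth 0 v i)) (side (cg c) i))).
(** Either one side is settled, or for some row [m] no list of claims can survive while every side
    of the first kind fails. Both exclude that all sides of a generic fail. *)
Definition met (c : cond) :=
  (exists i, i < k /\ ((nth 0 ty i = 0 /\ dead1 c i) \/ (nth 0 ty i <> 0 /\ win2 c i))) \/
  (exists m, forall e, fle e c -> forall v, exists2 e', fle e' e & fire m v e').

Section Families.
Variable c : cond.

Let L := mkseq (fun i => ec (side (cg c) i)) k.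

Lemma dcL i : i < k -> dc (nth 0 L i) = side (cg c) i.
Proof. by move=> hi; rewrite nth_mkseq // dcK. Qed.

Let name := (nat * seq nat * (nat * nat))%type.

(* A name [(i, t, (x, y))] in [Bd] stands for the extension of side [i] to [t]. It makes [U] small if
   the new reservoir [U] forces the relation of a side of the first kind to fail at
   all [(x, m')], or the relation of a side of the second kind to hold at [(m, x)] with witness [y]. *)
Definition Bd (w : name) := w.1.1 < k /\ ext (dc (nth 0 L w.1.1)) (fresh c w.1.1) w.1.2.
Definition Bc (m : nat) (w : name) (h : nat -> nat) := forall t,
  ext w.1.2 (fun n => 0 < h n) t -> w.1.1 < k ->
  (nth 0 ty w.1.1 = 0 -> forall m' a : nat, ~ join_univ Z (R w.1.1) (w.2.1, m', a) t) /\
  (nth 0 ty w.1.1 <> 0 -> ~ join_univ Z (R w.1.1) (m, w.2.1, w.2.2) t).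

(** Here the definability of [A] enters: freshness is Sigma_2 because the graph of [A] is. *)
Lemma S2_fresh T (cT : coded T) (i n : T -> nat) : Deff i -> Deff n ->
  S2 (cO c) (fun x _ => fresh c (i x) (n x)).
Proof.
move=> hi hn; apply: S2_and; first by apply: S2_S1; apply: (reads_S1_pos (cXr c)).
by apply: (@S2_comp _ _ _ _ _ _ (fun x => (n x, i x)) (S2_reads (cZ c) A2)); deff.
Qed.

Lemma Bd2 : S2 (cO c) (fun w _ => Bd w).
Proof.
apply: S2_and; first by apply: S2_S1; s1.
by apply: S2_extends; [deff|deff|apply: S2_fresh; deff].
Qed.

Lemma Bc1 : S1 (cO c) (fun (x : nat * name) h => ~ Bc x.1 x.2 h).
Proof.
have hW : S1 (cO c) (fun (y : nat * ((nat * nat * nat) * seq nat)) _ => y.1 < k /\ join_univ Z (R y.1) y.2.1 y.2.2).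
  by apply: (S1_family k (P := fun i y _ => join_univ Z (R i) y.1 y.2)) => i; apply: S1_join_univ; apply: cZ.
apply: (@S1_ext _ _ _ (fun (x : nat * name) h => exists t, ext x.2.1.2 (fun n => 0 < h n) t /\
   ((nth 0 ty x.2.1.1 = 0 /\ exists m' a, x.2.1.1 < k /\ join_univ Z (R x.2.1.1) (x.2.2.1, m', a) t) \/
    (~ nth 0 ty x.2.1.1 = 0 /\ (x.2.1.1 < k /\ join_univ Z (R x.2.1.1) (x.1, x.2.2.1, x.2.2.2) t))))).
  move=> [m w] h /=; split=> [[t [he []]]|].
  - by move=> [t0 [m' [a [hk hw]]]] /(_ t he hk)[/(_ t0 m' a)].
  - by move=> [t0 [hk hw]] /(_ t he hk)[_ /(_ t0)].
  move/existsNP => [t /not_implyP[he /not_implyP[hk hn]]]; exists t; split=> //.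
  case: (pselect (nth 0 ty w.1.1 = 0)) => t0; [left|right]; split=> //.
    apply: contrapT => hn'; apply: hn; split=> // _ m' a hw; apply: hn'; by exists m', a.
  by split=> //; apply: contrapT => hn'; apply: hn; split.
apply: S1_ex; apply: S1_and; first by apply: S1_extends; [deff|deff|apply: S1_h_pos; deff].
apply: S1_or; apply: S1_and; [by s1| |by s1|].
  apply: S1_ex; apply: S1_ex => /=.
  by apply: (@S1_comp _ _ _ _ _ _ (fun x : nat * name * seq nat * nat * nat => (x.1.1.1.2.1.1, ((x.1.1.1.2.2.1, x.1.2, x.2), x.1.1.2))) hW); deff.
by apply: (@S1_comp _ _ _ _ _ _ (fun x : nat * name * seq nat => (x.1.2.1.1, ((x.1.1, x.1.2.2.1, x.1.2.2.2), x.2))) hW); deff.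
Qed.

Lemma Bc_mono m w (h h' : nat -> nat) : (forall x, 0 < h' x -> 0 < h x) -> Bc m w h -> Bc m w h'.
Proof. by move=> hh hB t ht; apply: hB; apply: ext_mono ht. Qed.

(** A disjoint union of names: tag 0 keeps the old generators, so the ideal only grows, and the
    other tags add the new ones. *)
Definition Dp (w : nat) := (nfst w = 0 /\ cD c (nsnd w)) \/ (~ nfst w = 0 /\ Bd (dc (nsnd w))).
Definition Cp (m : nat) (w : nat) (h : nat -> nat) :=
  (nfst w = 0 -> cC c (nsnd w) h) /\ (~ nfst w = 0 -> Bc m (dc (nsnd w)) h).

Lemma Dp2 : S2 (cO c) (fun w _ => Dp w).
Proof.
apply: S2_or; apply: S2_and.
- by apply: S2_S1; s1.
- by apply: (S2_comp (cD2 c) (f := nsnd)); deff.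
- by apply: S2_S1; s1.
by apply: (S2_comp Bd2 (f := fun w => dc (nsnd w))); deff.
Qed.

Lemma Cp1 : S1 (cO c) (fun (x : nat * nat) h => ~ Cp x.1 x.2 h).
Proof.
apply: (@S1_ext _ _ _ (fun (x : nat * nat) h => (nfst x.2 = 0 /\ ~ cC c (nsnd x.2) h) \/
  (~ nfst x.2 = 0 /\ ~ Bc x.1 (dc (nsnd x.2)) h))).
  move=> [m w] h; rewrite /Cp /=; case: (pselect (nfst w = 0)) => h0; split.
  - by case=> [[_ hn] [/(_ h0)]|[]].
  - by move=> hn; left; split=> // hC; apply: hn.
  - by case=> [[]//|[_ hn] [_ /(_ h0)]].
  - by move=> hn; right; split=> // hC; apply: hn.
apply: S1_or; apply: S1_and; [by s1| |by s1|].
  by apply: (S1_comp (cC1 c) (f := fun x : nat * nat => nsnd x.2)); deff.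
by apply: (S1_comp Bc1 (f := fun x : nat * nat => (x.1, dc (nsnd x.2) : name))); deff.
Qed.

Lemma Cp_mono m w (h h' : nat -> nat) : (forall x, 0 < h' x -> 0 < h x) -> Cp m w h -> Cp m w h'.
Proof.
move=> hh [h1 h2]; split=> h0; first by apply: (cCm hh); apply: h1.
by apply: (Bc_mono hh); apply: h2.
Qed.

Lemma Cp_fin m N : exists2 w, Dp w & forall h : nat -> nat, (forall x, 0 < h x -> x < N) -> Cp m w h.
Proof.
have [w hw hC] := cfin c N; exists (npair 0 w); first by left; rewrite nfstK nsndK.
by move=> h hh; split; rewrite nfstK nsndK // => _; apply: hC.
Qed.

Lemma small_Cp m Y : small c Y -> ideal Dp (Cp m) Y.
Proof.
elim=> [X h0|w Y' X X' hw hC _ IH hX]; first exact: ideal0.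
apply: (@idealU _ _ (npair 0 w) Y' X X') => //; first by left; rewrite nfstK nsndK.
by split; rewrite nfstK nsndK.
Qed.

Lemma Bd_Dp (w : name) : Bd w -> Dp (npair 1 (ec w)).
Proof. by right; rewrite nfstK nsndK dcK. Qed.

Lemma Bc_Cp m (w : name) h : Bc m w h -> Cp m (npair 1 (ec w)) h.
Proof. by split; rewrite nfstK nsndK // dcK. Qed.

End Families.
Lemma reads_piece O X h j : reads O X -> reads O h -> reads O (piece X h j).
Proof.
move=> hX hh.
have := S1_at (reads_refl O) hh (S1_piece hX (@Deff_const nat _ coded_nat _ j)).
move=> hp; apply: (@S1_comp _ _ _ _ O (fun (x : nat * nat * nat) _ => piece X h j x.1.2 = x.2)
  (fun x : nat * nat => (0, x.1, x.2)) hp).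
by deff.
Qed.

(** The open complement of the class of partitions of the reservoir whose pieces are made small by
    the listed names. *)
Definition no_cover c (x : nat * seq nat) (h : nat -> nat) :=
  (exists y, 0 < cX c y /\ size x.2 <= h y) \/
  exists j, j < size x.2 /\ ~ Cp c x.1 (nth 0 x.2 j) (piece (cX c) h j).

Lemma S1_no_cover c : S1 (cO c) (no_cover c).
Proof.
apply: S1_or.
  apply: S1_ex; apply: S1_and; first by apply: (reads_S1_pos (cXr c)); deff.
  apply: (@S1_ext _ _ _ (fun x h => exists v, h x.2 = v /\ size x.1.2 <= v)); last by s1.
  by move=> x h; split=> [[v [->]]|hh] //; exists (h x.2).
apply: S1_ex; apply: S1_and; first by s1.
apply: (@S1_subst _ _ _ (cO c) (fun (x : nat * seq nat * nat) h => ~ Cp c x.1.1 (nth 0 x.1.2 x.2) h)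
   (fun x h => piece (cX c) h x.2) (reads_refl _)).
  by apply: (@S1_piece _ _ _ _ (fun x : nat * seq nat * nat => x.2)); [apply: cXr|deff].
by apply: (S1_comp (Cp1 c) (f := fun x : nat * seq nat * nat => (x.1.1, nth 0 x.1.2 x.2))); deff.
Qed.

Let name := (nat * seq nat * (nat * nat))%type.

(* The names of the finitely many small sets that cover the reservoir bound an interval
   [[m, M]], which goodness places inside [S]. *)
Lemma met_small c : (forall m, ideal (Dp c) (Cp c m) (cX c)) -> exists2 d, fle d c & met d.
Proof.
move=> hall.
(* [(m, M)] is related if finitely many names with bounds up to [M] cover the reservoir. That the
   names lie in [Dp] is Sigma_2, and the existence of a covering partition is Pi_1 by
   compactness. *)
have [||m [M [[ws [hD [hM hn]]] ins]]] := (cgood c).2 (fun x => exists ws : seq nat,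
  (forall j, j < size ws -> Dp c (nth 0 ws j)) /\
  ((forall j, j < size ws -> (dc (nsnd (nth 0 ws j)) : name).2.1 <= x.2) /\
  ~ forall h, (forall y, h y < (size ws).+1) -> no_cover c (x.1, ws) h)).
- apply: S2_ex; apply: S2_and.
    apply: S2_ball => /=; first by deff.
    by apply: (S2_comp (Dp2 c) (f := fun x : nat * nat * seq nat * nat => nth 0 x.1.2 x.2)); deff.
  apply: S2_and.
    apply: S2_S1; apply: S1_def; apply: Def_all => /=.
    apply: Def_imp; apply: Def_true; first by deff.
    by deff.
  apply: S2_P1; apply: (@S1_ext _ _ _ (fun (x : nat * nat * seq nat) _ =>
     forall h, (forall y, h y < (size x.2).+1) -> no_cover c (x.1.1, x.2) h)).
    by move=> x _; split=> [hh|/contrapT//]; apply.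
  apply: (@S1_compact _ _ _ (fun (x : nat * nat * seq nat) h => no_cover c (x.1.1, x.2) h)); last by deff.
  by apply: (S1_comp (S1_no_cover c) (f := fun x : nat * nat * seq nat => (x.1.1, x.2))); deff.
- move=> m; have [ws [h [h1 h2 h3]]] := ideal_partition (@Cp_mono c m) (hall m).
  exists (\max_(j < size ws) (dc (nsnd (nth 0 ws j)) : name).2.1), ws; split=> //; split=> [j hj|hc].
    exact: (leq_bigmax (F := fun j : 'I_(size ws) => (dc (nsnd (nth 0 ws j)) : name).2.1) (Ordinal hj)).
  (* Truncation changes [h] only off the reservoir, where the value [size ws] may occur; this
     accounts for the bound [(size ws).+1]. *)
  have [y|[y [/= hy]]|[j [/= hj]]] := hc (fun x => minn (h x) (size ws)).
  - by rewrite ltnS geq_minr.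
  - by rewrite (minn_idPl (ltnW (h2 _ hy))) leqNgt h2.
  apply; apply: Cp_mono (h3 j hj) => x; rewrite !piece_gt0 => /andP[hx].
  by rewrite (minn_idPl (ltnW (h2 _ hx))) hx.
(* A covering partition whose join with [cO c] is good has pieces that are admissible reservoirs,
   and not all of them are small. *)
have [||h [hK hc gh]] := @good_basis S (cO c) (size ws).+1 (cgood c) (fun h => ~ no_cover c (m, ws) h).
- apply: (@S1_ext _ _ _ (fun _ h => no_cover c (m, ws) h)).
    by move=> _ h; split=> [hh|/contrapT//]; apply.
  by apply: (S1_comp (S1_no_cover c) (f := fun _ : nat => (m, ws))); deff.
- by move/existsNP: hn => [h /not_implyP[h1 h2]]; exists h.
have [j hj hpos] : exists2 j, j < size ws & ~ small c (piece (cX c) h j).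
  apply: contrapT => hno; apply: (@cpos c); apply: (@ideal_pieces _ _ (size ws) _ h) => [x hx|j hj].
    by rewrite ltnNge; apply/negP => hx'; apply: hc; left; exists x.
  by apply: contrapT => hs; apply: hno; exists j.
have hCp : Cp c m (nth 0 ws j) (piece (cX c) h j).
  by apply: contrapT => hC; apply: hc; right; exists j.
have hMj := hM j hj.
(* An old generator would make the piece small, so the name comes from [Bd] and says how to extend
   one side. *)
have [[w0 hw]|[w0]] := hD j hj.
  by case: hpos; apply: (ideal1 hw); apply: hCp.1.
have hB := hCp.2 w0; move: hB hMj.
set w := dc (nsnd (nth 0 ws j)) : name.
move=> hB hMj [hk hext]; rewrite dcL // in hext.
have hO : reads (join (cO c) h) (cO c) by apply: reads_joinl.
have [||d [hd hsd hXd _]] := @refine c w.1.1 w.1.2 (join (cO c) h) (piece (cX c) h j) hext hO gh _ _ hpos.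
- by apply: reads_piece; [apply: reads_trans hO (cXr c)|apply: reads_joinr].
- by move=> x; rewrite piece_gt0 => /andP[].
exists d => //; left; exists w.1.1; split=> //.
have hB' t : ext (side (cg d) w.1.1) (fun n => 0 < cX d n) t -> ext w.1.2 (fun n => 0 < piece (cX c) h j n) t.
  by rewrite hsd; apply: ext_mono => n; apply: hXd.
case: (pselect (nth 0 ty w.1.1 = 0)) => t0; [left|right]; split=> //.
  by exists w.2.1 => t /hB' /hB /(_ hk)[/(_ t0)].
exists m, w.2.1, w.2.2; split=> [x hx|t /hB' /hB /(_ hk)[_ /(_ t0)] //].
by apply: ins; move: hMj hx; rewrite /=; lia.
Qed.

(* Whatever values [v] are claimed on the sides of the second kind: if the reservoir had a partition
   into pieces on which no side of the first kind succeeds and none of these claims is refuted,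
   then it would be covered by small sets. *)
Lemma met_large c m : ~ ideal (Dp c) (Cp c m) (cX c) -> exists2 d, fle d c & met d.
Proof.
move=> hpos; have hC : S1 (cO c) (fun w h => ~ Cp c m w h).
  by apply: (S1_comp (Cp1 c) (f := fun w : nat => (m, w))); deff.
exists (@Cond (cg c) (cO c) (cX c) (Dp c) (Cp c m) (cgood c) (cZ c) (cXr c) (@cX0 c) (Dp2 c)
   hC
   (@Cp_mono c m) (@Cp_fin c m) hpos).
  by split=> //=; [exact: prefix_refl|lia|exact: small_Cp].
set d := Cond _ _ _ _ _ _ _ _ _.
right; exists m => e hed v.
pose (Le := mkseq (fun i => ec (side (cg e) i)) k).
(* [N (m1, M) h]: below [M], the partition [h] leaves room for a success in row [m1] on a side of
   the first kind or for the refutation of a claim. *)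
pose (N := fun (x : nat * nat) (h : nat -> nat) => exists (i : nat) (t : seq nat), i < k /\ (size t <= x.2 /\
  (ext (dc (nth 0 Le i)) (fun n => 0 < piece (cX e) h i n) t /\
  ((nth 0 ty i = 0 /\ exists m', m' <= x.2 /\ exists a, i < k /\ join_univ Z (R i) (x.1, m', a) t) \/
   (~ nth 0 ty i = 0 /\ (i < k /\ join_univ Z (R i) (m, nfst (nth 0 v i), nsnd (nth 0 v i)) t)))))).

have hN : S1 (cO e) N.
  have hW : S1 (cO e) (fun (y : nat * ((nat * nat * nat) * seq nat)) _ => y.1 < k /\ join_univ Z (R y.1) y.2.1 y.2.2).
    by apply: (S1_family k (P := fun i y _ => join_univ Z (R i) y.1 y.2)) => i; apply: S1_join_univ; apply: cZ.
  apply: S1_ex; apply: S1_ex => /=; apply: S1_and; first by s1.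
  apply: S1_and; first by s1.
  apply: S1_and.
    apply: (@S1_extends _ _ _ (fun x : nat * nat * nat * seq nat => dc (nth 0 Le x.1.2)) (fun x => x.2)
      (fun x h n => 0 < piece (cX e) h x.1.2 n)); [by deff|by deff|].
    apply: (@S1_ext _ _ _ (fun (x : nat * nat * nat * seq nat * nat) h => 0 < cX e x.2 /\ h x.2 = x.1.1.2)).
      by move=> x h; rewrite piece_gt0; split=> [[-> ->]|/andP[-> /eqP]]; rewrite ?eqxx.
    by apply: S1_and; [apply: (reads_S1_pos (cXr e)); deff|s1].
  apply: S1_or; apply: S1_and; [by s1| |by s1|].
    apply: S1_ex; apply: S1_and; first by s1.
    apply: S1_ex => /=.
    by apply: (@S1_comp _ _ _ _ _ _ (fun x : nat * nat * nat * seq nat * nat * nat => (x.1.1.1.2, ((x.1.1.1.1.1, x.1.2, x.2), x.1.1.2))) hW); deff.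
  by apply: (@S1_comp _ _ _ _ _ _ (fun x : nat * nat * nat * seq nat => (x.1.2, ((m, nfst (nth 0 v x.1.2), nsnd (nth 0 v x.1.2)), x.2))) hW); deff.
case: (pselect (forall m1, exists M, forall h, (forall x, h x < k) -> N (m1, M) h)) => tot.
  have [||m1 [M [hM out]]] := (cgood e).1 (fun x => forall h, (forall y, h y < k) -> N x h) => //.
    by apply: S1_compact hN _; deff.
  (* The bound serves all partitions at once, so it applies to [A], although [A] is not assumed to
     be readable from the oracle. *)
  have [i [t [hi [ht [he hw]]]]] := hM A Ak; rewrite dcL // in he.
  have he' : ext (side (cg e) i) (fresh e i) t.
    by apply: ext_mono he => n; rewrite piece_gt0 => /andP[h1 /eqP h2].
  have [|e' [hle hsd hX _]] := @refine e i t (cO e) (cX e) he' (reads_refl _) (cgood e) (cXr e) _ (@cpos e) => //.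
  exists e' => //; exists i; split=> //.
  case: hw => [[t0 [m' [hm' [a [_ hW]]]]]|[t0 [_ hW]]]; [left|right]; split=> //; last by rewrite hsd.
  exists m1, m', a; rewrite hsd; split=> // x hx; apply: out; move: hm' => /=; lia.
case: (@cpos e); move/existsNP: tot => [m1 hm1].
have [h hK hno] : exists2 h, forall x, h x < k & forall M, ~ N (m1, M) h.
  apply: contrapT => hn; apply: hm1; apply: (compact_union hN) => [M M' h hM|h hK].
    move=> [i [t [h1 [h2 [h3 h4]]]]]; exists i, t; split=> //; split; first exact: leq_trans hM.
    split=> //; case: h4 => [[t0 [m' [hm' hW]]]|]; [left|by right].
    by split=> //; exists m'; split=> //; apply: leq_trans hM.
  by apply: contrapT => hM; apply: hn; exists h => // M hMh; apply: hM; exists M.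
apply: (@ideal_pieces _ _ k _ h) => [x _ //|i hi].
have [_ _ _ hsmall] := hed; apply: hsmall.
(* The partition [h] leaves no room for success, so the current side [i] of [e] names a generator
   that makes piece [i] small, for every [i]. *)
pose (w := (i, side (cg e) i, if nth 0 ty i == 0 then (m1, 0) else (nfst (nth 0 v i), nsnd (nth 0 v i))) : name).
apply: (@ideal1 _ _ (npair 1 (ec w))).
  by apply: Bd_Dp; split=> //; rewrite dcL //; exact: (fle_side i hed).
apply: Bc_Cp => t /= ht _; split=> t0.
  rewrite t0 eqxx => m' a hW; apply: (hno (maxn (size t) m')); exists i, t; rewrite dcL //.
  split=> //; split; first by rewrite leq_maxl.
  split=> //; left; split=> //; exists m'; split; first by rewrite leq_maxr.
  by exists a.
case: eqP => // _ /= hW; apply: (hno (size t)); exists i, t; rewrite dcL //.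
by split=> //; split=> //; split=> //; right.
Qed.

Lemma metP c : exists2 d, fle d c & met d.
Proof.
case: (pselect (forall m, ideal (Dp c) (Cp c m) (cX c))) => [|/existsNP[m]]; first exact: met_small.
exact: met_large.
Qed.

End Requirement.

(** * The generic sequence and its good side *)

Section Generic.
Variable Rr : nat -> nat -> nat.
Hypotheses (Rr1 : forall x y, Rr x y < 2) (RrZ : forall x, reads Z (Rr x)).
Hypotheses (gZ : good S Z) (rX0 : reads Z X0) (infX0 : forall n, exists2 x, n <= x & 0 < X0 x).

(** The initial ideal is that of the finite sets, with [N] naming the subsets of the numbers below
    [N]. *)
Lemma start : exists c : cond, cg c = [::].
Proof.
have h1 x : 0 < X0 x -> 0 < X0 x /\ size (@nil nat) <= x by [].
have h2 : S2 Z (fun (_ : nat) _ => True) by apply: S2_S1; apply: S1_def; def.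
pose C (N : nat) (h : nat -> nat) := forall x, 0 < h x -> x < N.
have h3 : S1 Z (fun N h => ~ C N h).
  apply: (@S1_ext _ _ _ (fun N h => exists x, 0 < h x /\ N <= x)).
    move=> N h; split=> [[x [hx hN]] /(_ x hx)|/existsNP[x /not_implyP[hx /negP]]]; first lia.
    by rewrite -leqNgt => hN; exists x.
  by apply: S1_ex; apply: S1_and; [apply: S1_h_pos; deff|s1].
have h4 w (h h' : nat -> nat) : (forall x, 0 < h' x -> 0 < h x) -> C w h -> C w h'.
  by move=> hh hC x /hh; apply: hC.
have h5 N : exists2 w, True & forall h : nat -> nat, (forall x, 0 < h x -> x < N) -> C w h.
  by exists N.
have h6 : ~ ideal (fun=> True) C X0.
  move=> hI; have [N hN] : exists N, C N X0.
    elim: hI => [X hX|w Y X X' _ hC _ [N hN] hX]; first by exists 0 => x; rewrite hX.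
    by exists (maxn w N) => x /hX[/hC|/hN]; rewrite leq_max => ->; rewrite ?orbT.
  by have [x hx /hN] := infX0 N; rewrite ltnNge hx.
by exists (Cond gZ (reads_refl Z) rX0 h1 h2 h3 h4 h5 h6).
Qed.

Let index := (nat * (nat * nat) * (seq nat * seq nat * seq nat))%type.

(** Tag 0 makes the limit total, tag 1 makes each side infinite, tag 2 gives cohesiveness for [Rr],
    tag 3 meets a requirement, and the other tags decide [fire]. *)
Definition fdense (x : index) (c : cond) : Prop :=
  let: (tag, (m, n), (ty, rs, v)) := x in
  match tag with
  | 0 => n <= size (cg c)
  | 1 => m < k -> exists x, n <= x < size (cg c) /\ (0 < nth 0 (cg c) x /\ A x = m)
  | 2 => exists j, forall y, 0 < cX c y -> Rr m y = j
  | 3 => met ty rs c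
  | _ => fire ty rs m v c \/ forall d, fle d c -> ~ fire ty rs m v d
  end.

Lemma long_cond (c : cond) n : exists2 d, fle d c & n <= size (cg d).
Proof.
pose t := mkseq (fun x => nth 0 (side (cg c) 0) x) (maxn n (size (cg c))).
have [||d [hd hs _ _]] := @refine c 0 t (cO c) (cX c) _ (reads_refl _) (cgood c) (cXr c) _ (@cpos c) => //.
  split; first by rewrite size_side size_mkseq leq_maxr.
  split=> x; rewrite size_side ?size_mkseq => hx.
    by rewrite nth_mkseq // leq_max hx orbT.
  case: (ltnP x (size (cg c))) => h; [by left|right; left].
  by rewrite nth_mkseq // nth_default // size_side.
by exists d => //; rewrite -(size_side _ 0) hs size_mkseq leq_maxl.
Qed.

Lemma add_element (c : cond) i x : fresh c i x -> exists d, [/\ fle d c, x < size (cg d),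
  0 < nth 0 (cg d) x & A x = i].
Proof.
move=> [hx hi]; have [_ hs] := cX0 hx.
pose t := mkseq (fun y => if y < size (cg c) then nth 0 (side (cg c) i) y else (y == x)) x.+1.
have [||d [hd hsd _ _]] := @refine c i t (cO c) (cX c) _ (reads_refl _) (cgood c) (cXr c) _ (@cpos c) => //.
  split; first by rewrite size_side size_mkseq leqW.
  split=> y; rewrite size_side ?size_mkseq => hy.
    by rewrite nth_mkseq ?hy //; lia.
  case: (ltnP y (size (cg c))) => h; [by left|right].
  rewrite nth_mkseq // ltnNge h /=; case: eqP => [->|_]; [by right|by left].
have sz : size (cg d) = x.+1 by rewrite -(size_side _ i) hsd size_mkseq.
have : nth 0 (side (cg d) i) x = 1 by rewrite hsd nth_mkseq // ltnNge hs eqxx.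
rewrite nth_side ?sz // => h; exists d; split; rewrite ?sz //.
by move: h; case: (0 < _).
Qed.

Lemma fdenseP : (forall (c : cond) i, i < k -> exists x, fresh c i x) ->
  forall x c, exists2 d, fle d c & fdense x d.
Proof.
move=> hfresh [[tag [m n]] [[ty rs] v]] c; rewrite /fdense.
case: tag => [|[|[|[|_]]]].
- exact: long_cond.
- case: (ltnP m k) => [hm|_]; last by exists c => //; apply: fle_refl.
  have [d hd hn] := long_cond c n; have [x hx] := hfresh d m hm.
  have [e [he h1 h2 h3]] := add_element hx.
  exists e; first exact: fle_trans he hd.
  by move=> _; exists x; rewrite h1 (leq_trans hn) //; case: (cX0 hx.1).
(* The reservoir splits into two pieces readable from the same oracle, and they cannot both be
   small. *)
- have [j hj] : exists j, ~ small c (piece (cX c) (Rr m) j).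
    apply: contrapT => hn; apply: (@cpos c); apply: (@ideal_pieces _ _ 2 _ (Rr m)) => [//|j _].
    by apply: contrapT => hj; apply: hn; exists j.
  have [|||d [hd _ hX _]] := @refine c 0 (side (cg c) 0) (cO c) (piece (cX c) (Rr m) j) _ (reads_refl _) (cgood c) _ _ hj.
  + exact: ext_refl.
  + by apply: reads_piece; [apply: cXr|apply: reads_trans (cZ c) (RrZ m)].
  + by move=> x; rewrite piece_gt0 => /andP[].
  by exists d => //; exists j => y /hX; rewrite piece_gt0 => /andP[_ /eqP].
- exact: metP.
case: (pselect (exists2 d, fle d c & fire ty rs m v d)) => [[d hd hf]|hn].
  by exists d => //; left.
by exists c; [apply: fle_refl|right=> d hd hf; apply: hn; exists d].
Qed.

Definition infinite (X : nat -> nat) := forall n, exists2 x, n <= x & 0 < X x.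

(** Both ways of failing goodness get one shape, a type and an index of a relation on triples, so
    that the failures of all sides fit into the lists [ty] and [rs]. *)
Lemma good_or (O : nat -> nat) : good S O \/ exists t r, 
  (t = 0 /\ (forall m : nat, exists m' a : nat, univ r (m, m', a) O) /\
    forall m m' a : nat, univ r (m, m', a) O -> ~ outside S m m') \/
  (t <> 0 /\ (forall m : nat, exists m' a : nat, ~ univ r (m, m', a) O) /\
    forall m m' a : nat, ~ univ r (m, m', a) O -> ~ inside S m m').
Proof.
case: (pselect (good S O)) => [|hn]; [by left|right].
apply: contrapT => hno; apply: hn; apply: goodI => r tot.
  have [|r' hr'] := @S1_universal _ _ O (fun x : nat * nat * nat => univ r x.1 O).
    apply: (@S1_at _ _ O O O (fun (x : nat * nat * nat) h => univ r x.1 h) (reads_refl O) (reads_refl O)).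
    by apply: (S1_comp (S1_univ _ O r) (f := fun x : nat * nat * nat => x.1)); deff.
  apply: contrapT => hno'; apply: hno; exists 0, r'; left; split=> //; split.
    by move=> m; have [m' hm'] := tot m; exists m', 0; apply/hr'.
  by move=> m m' a /hr' hU ho; apply: hno'; exists m, m'.
apply: contrapT => hno'; apply: hno; exists 1, r; right; split=> //; split=> // m m' a hU hi.
by apply: hno'; exists m, m', a.
Qed.

(** All sides are built at once and only one is claimed to be good: the failures of all sides
    together would define a disjunctive requirement that the sequence has met. *)
Lemma generic_side : (forall (c : cond) i, i < k -> exists x, fresh c i x) ->
  exists i G, [/\ i < k, infinite G, forall x, 0 < G x -> 0 < X0 x /\ A x = i,
    good S (join Z G) & forall x, exists N j, forall y, N <= y -> 0 < G y -> Rr x y = j].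
Proof.
move=> hfresh; have [c0 e0] := start.
have [||c [ec0 mono hD]] := generic_sequence c0 _ _ (fdenseP hfresh).
- exact: fle_refl.
- exact: fle_trans.
have pre i j : i <= j -> prefix (cg (c i)) (cg (c j)) by move=> /mono[].
have long n : exists j, n <= size (cg (c j)) by have [j hj] := hD (0, (0, n), ([::], [::], [::])); exists j.
have [G hG] := string_limit pre long.
pose Gs i x := (0 < G x) && (A x == i) : nat.
have sdG i n : side (cg (c n)) i = mkseq (Gs i) (size (cg (c n))).
  rewrite /side; apply/eq_in_map => x; rewrite mem_iota => /andP[_ hx].
  by rewrite /Gs {1}hG nth_mkseq.
have WG i r t : univ r t (join Z (Gs i)) <-> exists n, join_univ Z r t (side (cg (c n)) i).
  rewrite univ_join; split=> [[l hl]|[n]]; last by rewrite sdG; eexists; eassumption.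
  have [n hn] := long l; exists n; apply: join_univ_prefix hl; rewrite sdG.
  by rewrite prefixE size_mkseq take_mkseq_le.
have WGmax i r t n : univ r t (join Z (Gs i)) -> exists2 j, n <= j & join_univ Z r t (side (cg (c j)) i).
  move=> /WG[j hj]; exists (maxn n j); first exact: leq_maxl.
  apply: join_univ_prefix hj; rewrite !sdG prefixE size_mkseq take_mkseq_le //.
  by apply: size_prefix; apply: pre; apply: leq_maxr.
have extG i n j : n <= j -> ext (side (cg (c n)) i) (fun x => 0 < cX (c n) x) (side (cg (c j)) i).
  by move=> /mono hnj; apply: ext_mono (fle_side i hnj) => x [].
have inG n x : size (cg (c n)) <= x -> 0 < G x -> 0 < cX (c n) x.
  move=> hx hGx; have [j hj] := long x.+1.
  have hm : x < size (cg (c (maxn n j))).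
    by apply: leq_trans hj _; apply: size_prefix; apply: pre; apply: leq_maxr.
  have [_ hnew _ _] := mono _ _ (leq_maxl n j).
  by apply: hnew; [rewrite hx|rewrite hG nth_mkseq].
have [i hi gi] : exists2 i, i < k & good S (join Z (Gs i)).
  apply: contrapT => hno.
  have hbad i : i < k -> exists t r,
      (t = 0 /\ (forall m : nat, exists m' a : nat, univ r (m, m', a) (join Z (Gs i))) /\
        forall m m' a : nat, univ r (m, m', a) (join Z (Gs i)) -> ~ outside S m m') \/
      (t <> 0 /\ (forall m : nat, exists m' a : nat, ~ univ r (m, m', a) (join Z (Gs i))) /\
        forall m m' a : nat, ~ univ r (m, m', a) (join Z (Gs i)) -> ~ inside S m m').
    by move=> hi; have [g|//] := good_or (join Z (Gs i)); case: hno; exists i.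
  have [ty hty] := bounded_seq hbad; have [rs hrs] := bounded_seq hty.
  have nwin1 n i : i < k -> nth 0 ty i = 0 -> ~ win1 rs (c n) i.
    move=> hi t0 [m [m' [a [ho hW]]]]; have [[_ [_ hn]]|[]//] := hrs i hi.
    by apply: (hn m m' a) ho; apply/WG; exists n.
  have [n [[i [hi [[t0 [m hdead]]|[t0 [m [m' [a [hin hwin]]]]]]]]|[m hm]]] :=
    hD (3, (0, 0), (ty, rs, [::])).
  - have [[_ [tot _]]|[]//] := hrs i hi; have [m' [a /(WGmax _ _ _ n)[j hj hW]]] := tot m.
    by apply: hdead hW; apply: extG.
  - have [[]//|[_ [_ hn]]] := hrs i hi; apply: (hn m m' a) hin => /(WGmax _ _ _ n)[j hj].
    by apply: hwin; apply: extG.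
  (* These claims are true of the completed sides, so no stage of the construction refutes them. *)
  have [v hv] : exists v, forall i, i < k -> nth 0 ty i <> 0 ->
      ~ univ (nth 0 rs i) (m, nfst (nth 0 v i), nsnd (nth 0 v i)) (join Z (Gs i)).
    apply: (@bounded_seq k (fun i a => nth 0 ty i <> 0 -> ~ univ (nth 0 rs i) (m, nfst a, nsnd a) (join Z (Gs i)))).
    move=> i hi; have [[t0 _]|[_ [tot _]]] := hrs i hi; first by exists 0.
    by have [m' [a hU]] := tot m; exists (npair m' a) => _; rewrite nfstK nsndK.
  have nfire j : ~ fire ty rs m v (c j).
    move=> [i [hi [[t0 /(nwin1 _ _ hi t0)]|[t0 hW]]]] //.
    by apply: (hv i hi t0); apply/WG; exists j.
  have [j [/nfire //|hj]] := hD (4, (m, 0), (ty, rs, v)).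
  have [e he hf] := hm _ (mono _ _ (leq_maxl n j)) v.
  by apply: (hj e) hf; apply: fle_trans he (mono _ _ (leq_maxr _ _)).
have GsP x : 0 < Gs i x -> 0 < G x /\ A x = i by rewrite /Gs lt0b => /andP[-> /eqP].
exists i, (Gs i); split=> //.
- move=> n; have [j /(_ hi)[x [/andP[h1 h2] [h3 h4]]]] := hD (1, (i, n), ([::], [::], [::])).
  exists x => //; rewrite /Gs h4 eqxx andbT lt0b.
  by move: h3; rewrite hG nth_mkseq.
- move=> x /GsP[hx ->]; split=> //.
  by have [|] := cX0 (inG 0 x _ hx); rewrite ?ec0 ?e0.
move=> x; have [n [j hj]] := hD (2, (x, 0), ([::], [::], [::])).
exists (size (cg (c n))), j => y hy /GsP[hGy _].
by apply: hj; apply: inG.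
Qed.

End Generic.
End Forcing.

(** * Ramsey's theorem for good oracles *)

(** If the reservoir of some condition misses a class of [A], that reservoir is itself the set
    avoiding the class; otherwise every side can always be enlarged and the generic construction
    runs. *)
Lemma generic_or_avoid S Z X0 A k (Rr : nat -> nat -> nat) : 0 < k -> (forall x, A x < k) ->
  S2 Z (fun (x : nat * nat) _ => A x.1 = x.2) ->
  (forall x y, Rr x y < 2) -> (forall x, reads Z (Rr x)) -> good S Z -> reads Z X0 -> infinite X0 ->
  (exists i G, [/\ i < k, infinite G, forall x, 0 < G x -> 0 < X0 x /\ A x = i,
    good S (join Z G) & forall x, exists N j, forall y, N <= y -> 0 < G y -> Rr x y = j]) \/
  (exists i X, [/\ i < k, infinite X, forall x, 0 < X x -> 0 < X0 x /\ A x <> i & good S (join Z X)]).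
Proof.
move=> k0 Ak A2 Rr1 RrZ gZ rX0 infX0.
case: (pselect (forall (c : cond S Z X0) i, i < k -> exists x, fresh A c i x)) => h.
  by left; apply: (generic_side (A := A) (k := k)) => //.
right; apply: contrapT => hn; apply: h => c i hi; apply: contrapT => hx; apply: hn.
exists i, (cX c); split=> //.
- exact: infinite_cX.
- move=> x hcx; have [h1 _] := cX0 hcx; split=> // hA; apply: hx; by exists x.
by apply: good_reads (cgood c); apply: reads_join (cZ c) (cXr c).
Qed.

(** * Thinning to a homogeneous set *)

Section Thinning.
Variables (H0 : nat -> nat) (F : nat -> nat) (i : nat).

Fixpoint greedy_string (n : nat) : seq nat :=
  if n is m.+1 then
    let s := greedy_string m in
    rcons s ((0 < H0 m) && all (fun x => (nth 0 s x == 0) || (F (npair x m) == i)) (iota 0 m))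
  else [::].

Definition greedy n := nth 0 (greedy_string n.+1) n.

Lemma size_greedy n : size (greedy_string n) = n.
Proof. by elim: n => //= n IH; rewrite size_rcons IH. Qed.

Lemma greedy_stringE n : greedy_string n = mkseq greedy n.
Proof.
elim: n => // n IH; rewrite mkseqS -IH /greedy /= nth_rcons size_greedy ltnn eqxx //.
Qed.

Lemma greedyE n : greedy n =
  (0 < H0 n) && all (fun x => (greedy x == 0) || (F (npair x n) == i)) (iota 0 n).
Proof.
rewrite {1}/greedy /= nth_rcons size_greedy ltnn eqxx; congr (nat_of_bool (_ && _)).
apply: eq_in_all => x; rewrite mem_iota => /andP[_ hx].
by rewrite greedy_stringE nth_mkseq.
Qed.

Lemma greedyP n : 0 < greedy n <-> 0 < H0 n /\ forall x, x < n -> greedy x = 0 \/ F (npair x n) = i.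
Proof.
rewrite greedyE lt0b; split=> [/andP[-> /allP h]|[-> h]].
  by split=> // x hx; have := h x; rewrite mem_iota => /(_ hx) /orP[/eqP|/eqP]; tauto.
by apply/allP => x; rewrite mem_iota => /andP[_ /h[->|->]]; rewrite eqxx ?orbT.
Qed.

Lemma greedy01 n : greedy n = 0 \/ greedy n = 1.
Proof. by rewrite greedyE; case: (_ && _); [right|left]. Qed.

(** A local check that [s] is an initial segment of [greedy]. Both outcomes, including the
    inequality through [v], are phrased positively so that the check is [S1]. *)
Definition greedy_trace (s : seq nat) := forall m, m < size s ->
  (nth 0 s m = 1 /\ (0 < H0 m /\ forall x, x < m -> nth 0 s x = 0 \/ F (npair x m) = i)) \/
  (nth 0 s m = 0 /\ (H0 m = 0 \/ exists x, x < m /\ (~ nth 0 s x = 0 /\ exists v, F (npair x m) = v /\ ~ v = i))).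

Lemma greedy_traceP s : greedy_trace s <-> s = mkseq greedy (size s).
Proof.
split=> [hs|->].
  apply: (@eq_from_nth _ 0) => [|n hn]; rewrite ?size_mkseq // nth_mkseq //.
  elim/ltn_ind: n hn => n IH hn.
  have IH' x : x < n -> nth 0 s x = greedy x by move=> hx; apply: IH => //; apply: ltn_trans hn.
  have [[-> [h1 h2]]|[-> h]] := hs n hn.
    have [h|->//] := greedy01 n; have : 0 < greedy n; last by rewrite h.
    by apply/greedyP; split=> // x hx; rewrite -IH' //; apply: h2.
  have [->//|h'] := greedy01 n; have /greedyP[g1 g2] : 0 < greedy n by rewrite h'.
  case: h => [h|[x [hx [h1 [v [h2 h3]]]]]]; first by rewrite h in g1.
  by have [g|g] := g2 x hx; [case: h1; rewrite IH'|case: h3; rewrite -h2].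
move=> m; rewrite size_mkseq => hm; rewrite nth_mkseq //.
have E x : x < m -> nth 0 (mkseq greedy (size s)) x = greedy x.
  by move=> hx; rewrite nth_mkseq //; apply: ltn_trans hm.
have [h|h] := greedy01 m; [right|left]; split=> //; last first.
  have /greedyP[h1 h2] : 0 < greedy m by rewrite h.
  by split=> // x hx; rewrite E //; apply: h2.
case: (posnP (H0 m)) => [|h0]; [by left|right].
apply: contrapT => hn; have : 0 < greedy m; last by rewrite h.
apply/greedyP; split=> // x hx; have [|g] := greedy01 x; [by left|right].
apply: contrapT => hF; apply: hn; exists x; split=> //; rewrite E // g; split=> //.
by exists (F (npair x m)).
Qed.

Lemma reads_greedy O : reads O H0 -> reads O F -> reads O greedy.
Proof.
move=> hH hF.
apply: (@S1_ext _ _ _ (fun x _ => exists s, size s = x.1.+1 /\ (greedy_trace s /\ nth 0 s x.1 = x.2))).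
  move=> [n v] _ /=; split=> [[s [hs [/greedy_traceP e <-]]]|<-].
    by rewrite e hs nth_mkseq.
  exists (mkseq greedy n.+1); rewrite size_mkseq; split=> //; split.
    by apply/greedy_traceP; rewrite size_mkseq.
  by rewrite nth_mkseq.
apply: S1_ex; apply: S1_and; first by s1.
apply: S1_and; last by s1.
apply: S1_ball => /=; first by deff.
apply: S1_or; apply: S1_and; [by s1| |by s1|].
  apply: S1_and; first by apply: (reads_S1_pos hH); deff.
  apply: S1_ball => /=; first by deff.
  by apply: S1_or; [s1|apply: (reads_S1 hF); deff].
apply: S1_or; first by apply: (reads_S1 hH); deff.
apply: S1_ex; apply: S1_and; first by s1.
apply: S1_and; first by s1.
by apply: S1_ex; apply: S1_and; [apply: (reads_S1 hF); deff|s1].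
Qed.

(** If only elements below [n] were chosen, any large enough element of [H0] would have colour [i]
    with all of them and be chosen too. *)
Lemma infinite_greedy : infinite H0 ->
  (forall x, 0 < H0 x -> exists N, forall y, N <= y -> 0 < H0 y -> F (npair x y) = i) ->
  infinite greedy.
Proof.
move=> inf lim n; apply: contrapT => hn.
have hn' x : n <= x -> greedy x = 0.
  by move=> hx; apply/eqP; rewrite eqn0Ngt; apply/negP => g; apply: hn; exists x.
have [||N hN] := @bounded_choice n (fun x N => forall y, N <= y -> 0 < H0 y -> greedy x = 0 \/ F (npair x y) = i).
- by move=> x N N' hNN h y hy; apply: h; apply: leq_trans hy.
- move=> x hx; have [|g] := posnP (greedy x); first by exists 0; left.
  have /greedyP[/lim[N hN] _] := g; exists N => y h1 h2; right; exact: hN.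
have [y hy hHy] := inf (maxn n N); apply: hn; exists y.
  by apply: leq_trans hy; apply: leq_maxl.
apply/greedyP; split=> // x hx; have [h|/hn'] := ltnP x n; last by left.
by apply: hN => //; apply: leq_trans hy; apply: leq_maxr.
Qed.
End Thinning.

(** First a set [G] cohesive for the colourings [F (npair x y)] of [y], then an infinite subset of
    [G] on which the limit colour is constant, then thinning, which needs no further oracle. *)
Lemma ramsey_step S Z X F : good S Z -> reads Z X -> reads Z F -> infinite X ->
  (forall n, F n < 2) ->
  exists Z' H i, [/\ good S Z', reads Z' Z, reads Z' H, infinite H &
    (forall x, 0 < H x -> 0 < X x) /\
    forall x y, 0 < H x -> 0 < H y -> x < y -> F (npair x y) = i].
Proof.
move=> gZ rX rF infX F2.
have [||[i1 [G [_ infG GX gZ1 hcoh]]]|[i0 [Y [hi0 infY hY _]]]] :=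
  @generic_or_avoid S Z X (fun=> 0) 1 (fun x y => F (npair x y)) isT (fun=> isT) _ (fun _ _ => F2 _) _ gZ rX infX.
- by apply: S2_S1; s1.
- move=> x; apply: (@S1_ext _ _ _ (fun (y : nat * nat) _ => F (npair x y.1) = y.2)) => //.
  by apply: (reads_S1 rF); deff.
- set Z1 := join Z G in gZ1.
  have r1 : reads Z1 Z by apply: reads_joinl.
  have rG : reads Z1 G by apply: reads_joinr.
  have rF1 : reads Z1 F by apply: reads_trans rF.
  have /choice[A hA] : forall x, exists j, j < 2 /\ exists N, forall y, N <= y -> 0 < G y -> F (npair x y) = j.
    move=> x; have [N [j hj]] := hcoh x; exists j; split; last by exists N.
    by have [y hy hGy] := infG N; rewrite -(hj y hy hGy).
  have A2 : S2 Z1 (fun (x : nat * nat) _ => A x.1 = x.2).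
    (* Limits along [G] exist, so the graph of the limit colour is Sigma_2. *)
    apply: (@S2_ext _ _ _ (fun (x : nat * nat) _ => exists N, forall y, N <= y -> 0 < G y -> F (npair x.1 y) = x.2)).
      move=> [x j] _ /=; have [_ [N hN]] := hA x; split=> [[M hM]|<-]; last by exists N.
      have [y hy hGy] := infG (maxn N M).
      by rewrite -(hN y) ?(hM y) //; apply: leq_trans hy; rewrite ?leq_maxl ?leq_maxr.
    apply: S2_ex; apply: S2_P1 => /=.
    apply: (@S1_ext _ _ _ (fun (x : nat * nat * nat) _ => exists y, x.2 <= y /\ (0 < G y /\ exists v, F (npair x.1.1 y) = v /\ ~ v = x.1.2))).
      move=> [[x j] N] _ /=; split=> [[y [h1 [h2 [v [h3 h4]]]]] /(_ y h1 h2)|]; first by rewrite h3.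
      move=> /existsNP[y /not_implyP[h1 /not_implyP[h2 h3]]].
      by exists y; split=> //; split=> //; exists (F (npair x y)).
    apply: S1_ex; apply: S1_and; first by s1.
    apply: S1_and; first by apply: (reads_S1_pos rG); deff.
    by apply: S1_ex; apply: S1_and; [apply: (reads_S1 rF1); deff|s1].
  have A1 x : A x < 2 by have [] := hA x.
  have [H0 [i [infH hH gZ2]]] : exists H0 i, [/\ infinite H0, forall x, 0 < H0 x -> 0 < G x /\ A x = i & good S (join Z1 H0)].
    have [|[i [H0 [_ h1 h2 h3 _]]]|[i [H0 [hi h1 h2 h3]]]] :=
      @generic_or_avoid S Z1 G A 2 (fun _ _ => 0) isT A1 A2 (fun _ _ => isT) _ gZ1 rG infG.
    - by move=> x; rewrite /reads; s1.
    - by exists H0, i.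
    (* With two colours, avoiding one means having the other. *)
    exists H0, (1 - i); split=> // x /h2[-> hA']; split=> //.
    by move: (A1 x) hi hA'; lia.
  have r2 : reads (join Z1 H0) H0 by apply: reads_joinr.
  exists (join Z1 H0), (greedy H0 F i), i; split=> //.
  + by apply: reads_trans r1; apply: reads_joinl.
  + by apply: reads_greedy => //; apply: reads_trans rF1; apply: reads_joinl.
  + apply: infinite_greedy => // x /hH[_ <-]; have [_ [N hN]] := hA x.
    by exists N => y hy /hH[hGy _]; apply: hN.
  split=> [x /greedyP[/hH[/GX[]]] //|x y hx hy hxy].
  by have /greedyP[_ /(_ x hxy)[h|//]] := hy; rewrite h in hx.
(* In the cohesive stage [A] has a single class, which no infinite set avoids. *)
by have [y _ /hY[_]] := infY 0; case: i0 hi0 {hY} => [|[]].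
Qed.

Lemma ramsey_chain S O : good S O -> exists Zs : nat -> nat -> nat,
  [/\ reads (Zs 0) O, forall i j, i <= j -> reads (Zs j) (Zs i), forall n, good S (Zs n) &
   forall n X F, reads (Zs n) X -> reads (Zs n) F -> infinite X -> (forall n, F n < 2) ->
     exists m H i, [/\ reads (Zs m) H, infinite H, (forall x, 0 < H x -> 0 < X x) &
       forall x y, 0 < H x -> 0 < H y -> x < y -> F (npair x y) = i]].
Proof.
move=> gO.
(* Oracles are only appended, so an instance is named once and for all by the position of an oracle
   and two indices relative to it. *)
pose history := {s : seq (nat -> nat) | [/\ 0 < size s, good S (last O s) &
  forall i, i < size s -> reads (last O s) (nth O s i)]}.
pose le (t s : history) := size (sval s) <= size (sval t) /\
  forall i, i < size (sval s) -> nth O (sval t) i = nth O (sval s) i.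
pose (graph := fun (r : nat) (Z f : nat -> nat) => forall x : nat * nat, f x.1 = x.2 <-> univ r x Z).
pose D (j : nat * nat * nat) (s : history) := j.1.1 < size (sval s) /\
  forall X F, graph j.1.2 (nth O (sval s) j.1.1) X -> graph j.2 (nth O (sval s) j.1.1) F ->
    infinite X -> (forall n, F n < 2) ->
    exists H i, [/\ reads (last O (sval s)) H, infinite H, (forall x, 0 < H x -> 0 < X x) &
       forall x y, 0 < H x -> 0 < H y -> x < y -> F (npair x y) = i].
have s0P : [/\ 0 < size [:: O], good S (last O [:: O]) &
  forall i, i < size [:: O] -> reads (last O [:: O]) (nth O [:: O] i)].
  by split=> // -[|//] _; apply: reads_refl.
have append (s : history) Z : good S Z -> reads Z (last O (sval s)) ->
    exists2 t : history, le t s & sval t = rcons (sval s) Z.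
  case: s => s [h1 h2 h3] /= gZ rZ.
  have tP : [/\ 0 < size (rcons s Z), good S (last O (rcons s Z)) &
      forall i, i < size (rcons s Z) -> reads (last O (rcons s Z)) (nth O (rcons s Z) i)].
    rewrite size_rcons last_rcons; split=> // i.
    rewrite ltnS leq_eqVlt nth_rcons => /orP[/eqP->|hi]; first by rewrite ltnn eqxx; apply: reads_refl.
    by rewrite hi; apply: reads_trans rZ _; apply: h3.
  exists (exist _ (rcons s Z) tP) => //; split=> /=; first by rewrite size_rcons.
  by move=> i hi; rewrite nth_rcons hi.
have le_refl s : le s s by [].
have le_trans a b c : le a b -> le b c -> le a c.
  move=> [h1 h2] [h3 h4]; split; first exact: leq_trans h1.
  by move=> i hi; rewrite h2 ?h4 //; apply: leq_trans h3.
have grow (s : history) n : exists2 t, le t s & n < size (sval t).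
  elim: n => [|n [t ht hn]]; first by exists s => //; case: (svalP s).
  have [_ gt _] := svalP t; have [u hu eu] := append t _ gt (reads_refl _).
  by exists u; [apply: le_trans hu ht|rewrite eu size_rcons].
have dense j s : exists2 t, le t s & D j t.
  have [t ht hj] := grow s j.1.1; have [_ gt rt] := svalP t.
  case: (pselect (exists X F, [/\ graph j.1.2 (nth O (sval t) j.1.1) X, graph j.2 (nth O (sval t) j.1.1) F,
     infinite X & forall n, F n < 2])) => [[X [F [gX gF infX F2]]]|hn]; last first.
    by exists t => //; split=> // X F h1 h2 h3 h4; case: hn; exists X, F.
  have rg r f : graph r (nth O (sval t) j.1.1) f -> reads (last O (sval t)) f.
    move=> hg; apply: reads_trans (rt _ hj) _.
    set Z := nth _ _ _ in hg *.
    apply: (@S1_ext _ _ _ (fun (x : nat * nat) _ => univ r x Z)); first by move=> x _; rewrite hg.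
    exact: (@S1_at _ _ Z Z Z _ (reads_refl Z) (reads_refl Z) (S1_univ _ Z r)).
  have [Z' [H [i [gZ' rZ' rH infH [hHX hH]]]]] := ramsey_step gt (rg _ _ gX) (rg _ _ gF) infX F2.
  have [u hu eu] := append t _ gZ' rZ'.
  exists u; first exact: le_trans hu ht.
  split; first by rewrite eu size_rcons ltnS ltnW.
  move=> X' F'; rewrite (hu.2 _ hj) => gX' gF' _ _; exists H, i; rewrite eu last_rcons.
  have eX : X' = X by apply: funext => x; apply/(gX' (x, X x))/(gX (x, X x)).
  have eF : F' = F by apply: funext => x; apply/(gF' (x, F x))/(gF (x, F x)).
  by rewrite eX eF.
have [||c [c0 mono hD]] := generic_sequence (exist _ [:: O] s0P : history) _ _ dense => //.
have rmono i j : i <= j -> reads (last O (sval (c j))) (last O (sval (c i))).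
  move=> /mono[h1 h2]; have [hs _ _] := svalP (c i); have [_ _ hr] := svalP (c j).
  have lt : (size (sval (c i))).-1 < size (sval (c i)) by rewrite prednK.
  by rewrite -[last O (sval (c i))](nth_last O) -h2 //; apply: hr; apply: leq_trans h1.
exists (fun n => last O (sval (c n))); split=> //; first by rewrite c0; apply: reads_refl.
- by move=> n; case: (svalP (c n)).
move=> n X F rX rF infX F2.
have [rx hrx] := S1_universal rX; have [rf hrf] := S1_universal rF.
have [hs _ _] := svalP (c n).
have lastE : last O (sval (c n)) = nth O (sval (c n)) (size (sval (c n))).-1 by rewrite nth_last.
have [m [hm hm']] := hD ((size (sval (c n))).-1, rx, rf).
have eZ : nth O (sval (c m)) (size (sval (c n))).-1 = last O (sval (c n)).
  rewrite lastE; case: (leqP n m) => [/mono[_]|/ltnW/mono[_ ->//]]; apply.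
  by rewrite prednK.
have [||H [i [h1 h2 h3 h4]]] := hm' X F _ _ infX F2; rewrite ?eZ //.
by exists m, H, i.
Qed.

(** * The model *)

Definition char (Y : set nat) (n : nat) : nat := `[< Y n >].

Lemma charP (Y : set nat) n : 0 < char Y n <-> Y n.
Proof. by rewrite /char lt0b; split=> /asboolP. Qed.

Lemma reads_charP O (Y : set nat) : reads O (char Y) <->
  S1 O (fun (n : nat) _ => Y n) /\ S1 O (fun (n : nat) _ => ~ Y n).
Proof.
split=> [h|[h1 h2]].
  split; first by apply: S1_ext (reads_S1_pos h (Deff_id _)) => n _; rewrite charP.
  apply: (@S1_ext _ _ _ (fun n _ => char Y n = 0)); last by apply: (reads_S1 h); deff.
  by move=> n _; rewrite -(charP Y n); lia.
apply: (@S1_ext _ _ _ (fun (x : nat * nat) _ => (Y x.1 /\ x.2 = 1) \/ (~ Y x.1 /\ x.2 = 0))).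
  move=> [n v] _ /=; rewrite /char; case: asboolP => hn /=; split.
  - by case=> [[_ ->]//|[]//].
  - by move=> <-; left.
  - by case=> [[]//|[_ ->]//].
  - by move=> <-; right.
apply: S1_or; apply: S1_and; [|by s1| |by s1].
  by apply: (S1_comp h1); deff.
by apply: (S1_comp h2); deff.
Qed.

(** * Semantics of substitution and renaming *)

Lemma teval_tshift n e t : teval (scons n e) (tshift t) = teval e t.
Proof. by elim: t => //= a IHa b IHb; rewrite -IHa -IHb. Qed.

Lemma teval_tsubst e s t : teval e (tsubst s t) = teval (fun i => teval e (s i)) t.
Proof. by elim: t => //= a -> b ->. Qed.

Lemma sat_subst M p : forall e E s, sat M e E (subst s p) <-> sat M (fun i => teval e (s i)) E p.
Proof.
have upE n e s : (fun i => teval (scons n e) (up s i)) = scons n (fun i => teval e (s i)).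
  by apply: funext => -[|i] //=; rewrite teval_tshift.
elim: p => [a b|a b|a X|p IH|p IHp q IHq|p IHp q IHq|p IHp q IHq|p IH|p IH|p IH|p IH] e E s /=;
  rewrite ?teval_tsubst //.
- by rewrite IH.
- by rewrite IHp IHq.
- by rewrite IHp IHq.
- by rewrite IHp IHq.
- by split=> h n; have := h n; rewrite IH upE.
- by split=> -[n h]; exists n; move: h; rewrite IH upE.
- by split=> h B hB; have := h B hB; rewrite IH.
- by split=> -[B [hB h]]; exists B; split=> //; move: h; rewrite IH.
Qed.

Lemma sat_renS M p : forall e E r, sat M e E (renS r p) <-> sat M e (fun i => E (r i)) p.
Proof.
have upE (B : set nat) (E : nat -> set nat) r :
    (fun i => scons B E (up_ren r i)) = scons B (fun i => E (r i)).
  by apply: funext => -[|i].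
elim: p => [a b|a b|a X|p IH|p IHp q IHq|p IHp q IHq|p IHp q IHq|p IH|p IH|p IH|p IH] e E r //=.
- by rewrite IH.
- by rewrite IHp IHq.
- by rewrite IHp IHq.
- by rewrite IHp IHq.
- by split=> h n; have := h n; rewrite IH.
- by split=> -[n h]; exists n; move: h; rewrite IH.
- by split=> h B hB; have := h B hB; rewrite IH upE.
- by split=> -[B [hB h]]; exists B; split=> //; move: h; rewrite IH upE.
Qed.

Lemma sat_shiftS M e B E p : sat M e (scons B E) (shiftS p) <-> sat M e E p.
Proof. by rewrite sat_renS. Qed.

Lemma sat_at_zero M e E p : sat M e E (at_zero p) <-> sat M (scons 0 e) E p.
Proof.
rewrite sat_subst; suff -> : (fun i => teval e (scons Zero Var i)) = scons 0 e by [].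
by apply: funext => -[|i].
Qed.

Lemma sat_at_succ M n e E p : sat M (scons n e) E (at_succ p) <-> sat M (scons n.+1 e) E p.
Proof.
rewrite sat_subst; set f := (X in sat _ X _ _); suff -> : f = scons n.+1 e by [].
by apply: funext => -[|i]; rewrite /f //= addn1.
Qed.

(** Overrides the first variables by [s]. For fixed [i] the tail [mkseq e i.+1] is a constant, so a
    variable is a definable function of [s]. *)
Definition env (s : seq nat) (e : nat -> nat) (i : nat) : nat := nth 0 (s ++ mkseq e i.+1) i.

Lemma scons_env n s e : scons n (env s e) = env (n :: s) e.
Proof.
apply: funext => -[|i] //=; rewrite /env [in RHS]/=.
rewrite !nth_cat; case: ltnP => // h.
rewrite -[RHS]/(nth 0 (mkseq e i.+2) (i - size s)).
by rewrite !nth_mkseq //; lia.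
Qed.

Lemma env0 e : env [::] e = e.
Proof. by apply: funext => i; rewrite /env cat0s nth_mkseq. Qed.

Lemma Deff_teval e t : Deff (fun s => teval (env s e) t).
Proof.
elim: t => [i||| a IHa b IHb|a IHa b IHb] /=; try by deff.
by rewrite /env; deff.
Qed.

(** * The model of the sets read from a chain of oracles *)

Section Model.
Variables (Zs : nat -> nat -> nat).
Hypothesis Zs_mono : forall i j, i <= j -> reads (Zs j) (Zs i).

Definition chain_sets : set (set nat) := [set Y | exists n, reads (Zs n) (char Y)].

Lemma chain_sets_neq0 : chain_sets !=set0.
Proof.
exists set0, 0; apply/reads_charP; split; first by s1.
by apply: S1_def; apply: Def_not; apply: Def_prop.
Qed.

Definition chain_model := OmegaModel chain_sets_neq0.

Definition decided T {cT : coded T} (P : T -> Prop) := exists n,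
  S1 (Zs n) (fun x _ => P x) /\ S1 (Zs n) (fun x _ => ~ P x).

Lemma decided_not T (cT : coded T) (P : T -> Prop) : decided P -> decided (fun x => ~ P x).
Proof.
move=> [n [h1 h2]]; exists n; split=> //; apply: S1_ext h1 => x _.
by split=> [p hp|/contrapT].
Qed.

Lemma decided_and T (cT : coded T) (P Q : T -> Prop) :
  decided P -> decided Q -> decided (fun x => P x /\ Q x).
Proof.
move=> [n [h1 h2]] [m [h3 h4]]; exists (maxn n m).
have rn := Zs_mono (leq_maxl n m); have rm := Zs_mono (leq_maxr n m).
split; first by apply: S1_and; [apply: S1_reads h1|apply: S1_reads h3].
apply: (@S1_ext _ _ _ (fun x _ => ~ P x \/ ~ Q x)); first by move=> x _; rewrite not_andP.
by apply: S1_or; [apply: S1_reads h2|apply: S1_reads h4].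
Qed.

Lemma decided_ext T (cT : coded T) (P Q : T -> Prop) : (forall x, P x <-> Q x) -> decided P -> decided Q.
Proof.
move=> h [n [h1 h2]]; exists n; split; first by apply: S1_ext h1 => x _; apply: h.
by apply: S1_ext h2 => x _; rewrite h.
Qed.

Lemma decided_ball (P : seq nat -> Prop) (b : seq nat -> nat) : Deff b -> decided P ->
  decided (fun s => forall u, u < b s -> P (u :: s)).
Proof.
move=> hb [n [h1 h2]]; exists n; split.
  by apply: S1_ball => //; apply: (S1_comp h1 (f := fun x : seq nat * nat => x.2 :: x.1)); deff.
apply: (@S1_ext _ _ _ (fun s _ => exists u, u < b s /\ ~ P (u :: s))).
  move=> s _; split=> [[u [hu hP]] /(_ u hu)//|/existsNP[u /not_implyP[]]]; by exists u.
have hb' : Deff (fun x : seq nat * nat => b x.1) by apply: (Deff_comp hb); deff.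
apply: S1_ex; apply: S1_and; first by s1.
by apply: (S1_comp h2 (f := fun x : seq nat * nat => x.2 :: x.1)); deff.
Qed.

Section Formulas.
Variables (e : nat -> nat) (E : nat -> set nat).
Hypothesis hE : forall i, sets_of chain_model (E i).

Lemma decided_bounded p : bounded p -> decided (fun s => sat chain_model (env s e) E p).
Proof.
have dd (P : seq nat -> Prop) : Def P -> decided P.
  by move=> hP; exists 0; split; apply: S1_def => //; apply: Def_not.
elim=> [a b|a b|a X|q _ IH|q r _ IHq _ IHr|q r _ IHq _ IHr|q r _ IHq _ IHr|t q _ IH|t q _ IH].
- by apply: dd; apply: Def_eq; apply: Deff_teval.
- by apply: dd; apply: Def_true; apply: Deff_leq; [apply: Deff_succ|]; apply: Deff_teval.
- have [n /reads_charP[h1 h2]] := hE X; exists n.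
  by split; [apply: (S1_comp h1 (f := fun s => teval (env s e) a))|
    apply: (S1_comp h2 (f := fun s => teval (env s e) a))]; apply: Deff_teval.
- exact: decided_not.
- exact: decided_and.
- apply: decided_ext (decided_not (decided_and (decided_not IHq) (decided_not IHr))) => s /=.
  by rewrite not_andP; split=> [[/contrapT|/contrapT]|[h|h]]; tauto.
- apply: decided_ext (decided_not (decided_and IHq (decided_not IHr))) => s /=.
  by split=> [h hq|]; [apply: contrapT => hr; apply: h|tauto].
- apply: decided_ext (decided_ball (Deff_teval e t) IH) => s /=.
  by split=> h n; have := h n; rewrite teval_tshift scons_env.
apply: decided_ext (decided_not (decided_ball (Deff_teval e t) (decided_not IH))) => s /=.
split=> [/existsNP[n /not_implyP[hn /contrapT h]]|[n [hn h]] h'].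
  by exists n; rewrite teval_tshift scons_env.
by apply: (h' n); [rewrite teval_tshift in hn|rewrite -scons_env].
Qed.

Lemma Sigma1_S1 p : Sigma0 1 p -> exists n, S1 (Zs n) (fun x _ => sat chain_model (scons x e) E p).
Proof.
move=> hp; inversion hp as [|k q hq]; subst; inversion hq as [q' hb|]; subst.
have [n [h _]] := decided_bounded hb; exists n.
apply: (@S1_ext _ _ _ (fun x _ => exists y, sat chain_model (env [:: y; x] e) E q)).
  by move=> x _ /=; split=> -[y hy]; exists y; move: hy; rewrite -!scons_env env0.
by apply: S1_ex; apply: (S1_comp h (f := fun x : nat * nat => [:: x.2; x.1])); deff.
Qed.

Lemma Pi1_S1 p : Pi0 1 p -> exists n, S1 (Zs n) (fun x _ => ~ sat chain_model (scons x e) E p).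
Proof.
move=> hp; inversion hp as [|k q hq]; subst; inversion hq as [q' hb|]; subst.
have [n [_ h]] := decided_bounded hb; exists n.
apply: (@S1_ext _ _ _ (fun x _ => exists y, ~ sat chain_model (env [:: y; x] e) E q)).
  move=> x _ /=; split=> [[y hy] /(_ y)|/existsNP[y hy]].
    by move=> hy'; apply: hy; rewrite -!scons_env env0.
  by exists y; rewrite -!scons_env env0.
by apply: S1_ex; apply: (S1_comp h (f := fun x : nat * nat => [:: x.2; x.1])); deff.
Qed.
End Formulas.

Lemma chain_RCA0 : models chain_model RCA0.
Proof.
move=> p [q hq|q hq|q r hq hr] e E hE.
- case: hq => /=; try lia.
- move=> [/sat_at_zero h0 hS] n /=; elim: n => [|n IH]; first exact: h0.
  by apply/sat_at_succ; apply: hS.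
move=> h; have [n hn] := Sigma1_S1 e hE hq; have [m hm] := Pi1_S1 e hE hr.
exists [set x | sat chain_model (scons x e) E q]; split.
  exists (maxn n m); apply/reads_charP; split.
    by apply: S1_reads hn; apply: Zs_mono; apply: leq_maxl.
  apply: (@S1_ext _ _ _ (fun x _ => ~ sat chain_model (scons x e) E r)).
    by move=> x _; have [h1 h2] := h x; split=> h3 h4; apply: h3; [apply: h1|apply: h2].
  by apply: S1_reads hm; apply: Zs_mono; apply: leq_maxr.
by move=> x /=; rewrite sat_shiftS.
Qed.

End Model.

(** * The theorem *)

Definition pr (a b : nat) : nat := (a + b) * (a + b) + a.

(** [pr a b] lies between [(a + b)^2] and the next square, which determines [a + b] and then [a]. *)
Lemma pr_inj a b c d : pr a b = pr c d -> a = c /\ b = d.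
Proof.
rewrite /pr => h; have e : a + b = c + d by nia.
by rewrite e in h; lia.
Qed.

Lemma S1_preimage T (cT : coded T) O (P : nat -> Prop) (f : T -> nat) :
  S1 O (fun n _ => P n) -> Deff f -> S1 O (fun x _ => P (f x)).
Proof. by move=> h hf; apply: (S1_comp h (f := f)). Qed.

Lemma chain_RT22 (Zs : nat -> nat -> nat) :
  (forall i j, i <= j -> reads (Zs j) (Zs i)) ->
  (forall n X F, reads (Zs n) X -> reads (Zs n) F -> infinite X -> (forall n, F n < 2) ->
     exists m H i, [/\ reads (Zs m) H, infinite H, (forall x, 0 < H x -> 0 < X x) &
       forall x y, 0 < H x -> 0 < H y -> x < y -> F (npair x y) = i]) ->
  models (chain_model Zs) [set RT22].
Proof.
move=> mono ram _ -> e E hE X [n1 rX] infX C [n2 rC] [/= hC1 hC2].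
(* Exactly one of the two values is recorded for a pair, so the presence of the value 1 determines
   the colour. *)
pose c x y := C (pr (pr x y) 1).
have cP x y i : X x -> X y -> x < y -> C (pr (pr x y) i) -> (c x y /\ i = 1) \/ (~ c x y /\ i = 0).
  move=> hx hy hxy hCi.
  have [x' [y' [i' [_ [_ [_ [hi]]]]]]] := hC1 _ hCi; rewrite -/(pr _ _) => /pr_inj[_ ei].
  have [i0 [_ hu]] := hC2 x y (conj hx (conj hy hxy)).
  have ui : i = i0 by apply: hu.
  have [i1|i1] : i = 1 \/ i = 0 by lia.
    by left; split=> //; rewrite /c -i1.
  by right; split=> // /hu h1; lia.
pose F n : nat := `[< c (nfst n) (nsnd n) >].
pose N := maxn n1 n2.
have rX' : reads (Zs N) (char X) by apply: reads_trans rX; apply: mono; apply: leq_maxl.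
have /reads_charP[C1 C2] : reads (Zs N) (char C) by apply: reads_trans rC; apply: mono; apply: leq_maxr.
have rF : reads (Zs N) F.
  apply: (reads_charP (Zs N) (fun n => c (nfst n) (nsnd n))).2; split.
    by apply: (S1_preimage C1); rewrite /pr; deff.
  by apply: (S1_preimage C2); rewrite /pr; deff.
have infX' : infinite (char X).
  by move=> n; have [m [hm hX]] := infX n; exists m; [apply: ltnW|apply/charP].
have F2 n : F n < 2 by rewrite /F; case: asbool.
have [m [H [i [rH infH hHX hH]]]] := ram N (char X) F rX' rF infX' F2.
exists [set x | 0 < H x]; split.
  exists m; apply/reads_charP; split; first by apply: (reads_S1_pos rH); deff.
  apply: (@S1_ext _ _ _ (fun x _ => H x = 0)); first by move=> x _ /=; lia.
  by apply: (reads_S1 rH); deff.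
split=> [x /= /hHX /charP //|]; split=> [n|].
  by have [x hx hHx] := infH n.+1; exists x.
exists i => x y [/= hx [hy hxy]]; rewrite -/(pr x y) -/(pr (pr x y) i).
have Xx : X x by apply/charP/hHX.
have Xy : X y by apply/charP/hHX.
have := hH x y hx hy hxy; rewrite /F nfstK nsndK => <-.
case: asboolP => [//|hc].
have [j [hj _]] := hC2 x y (conj Xx (conj Xy hxy)).
by have [[]|[_ j0]] := cP x y j Xx Xy hxy hj; rewrite // -[X in pr _ X]/0 -j0.
Qed.

(* [x] is in the set defined by this formula iff [x] occurs only finitely often in the
   oracle whose graph is the parameter. *)
Definition finitely_often : formula :=
  (∃N ∀N (#1 < #0) ⇒ ¬ (pair_term #0 #2 ∈ 0))%SO.

Lemma finitely_often_Sigma02 : Sigma0 2 finitely_often.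
Proof. by repeat constructor. Qed.

(** An infinite [Y] read from a good oracle makes [m <= m'] with [m'] in [Y] total and Sigma_1,
    hence Sigma_2. The two halves of goodness put elements of [Y] outside and inside [S]. *)
Lemma chain_not_subset (Zs : nat -> nat -> nat) (O : nat -> nat) (S : nat -> Prop) :
  (forall x, S x <-> exists a, forall b, a < b -> O b <> x) ->
  reads (Zs 0) O -> (forall n, good S (Zs n)) ->
  ~ models (chain_model Zs) Sigma02_Subset.
Proof.
move=> hS rO gZ hM.
pose B : set nat := [set n | exists b, pr b (O b) = n].
have hB : sets_of (chain_model Zs) B.
  exists 0; apply/reads_charP; split.
    apply: (@S1_ext _ _ _ (fun n _ => exists b, exists v, O b = v /\ pr b v = n)).
      by move=> n _; split=> [[b [v [<- h]]]|[b h]]; [exists b|exists b, (O b)].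
    apply: S1_ex; apply: S1_ex; apply: S1_and; first by apply: (reads_S1 rO); deff.
    by rewrite /pr; s1.
  (* The search is bounded because [pr b v] is at least [b]. *)
  apply: (@S1_ext _ _ _ (fun n _ => forall b, b < n.+1 -> exists v, O b = v /\ ~ pr b v = n)).
    move=> n _; split=> [h [b hb]|h b _].
      have [|v [hv hn]] := h b; first by rewrite -hb /pr; nia.
      by apply: hn; rewrite -hv.
    by exists (O b); split=> // hb; apply: h; exists b.
  apply: S1_ball => /=; first by deff.
  apply: S1_ex; apply: S1_and; first by apply: (reads_S1 rO); deff.
  by rewrite /pr; s1.
have satS x (Y : set nat) : sat (chain_model Zs) (scons x (fun=> 0)) (scons Y (fun=> B)) (shiftS finitely_often) <-> S x.
  rewrite sat_shiftS hS /=; split=> -[a ha]; exists a => b hb.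
    by move=> hx; apply: (ha b hb); exists b; rewrite hx.
  by move=> [b']; rewrite -/(pr b x) => /pr_inj[eb h]; apply: (ha b hb); rewrite -eb.
have ax : Sigma02_Subset (subset_axiom finitely_often).
  by exists finitely_often => //; apply: finitely_often_Sigma02.
have [Y [[n rY] [infY hY]]] := hM _ ax (fun=> 0) (fun=> B) (fun=> hB).
have [Y1 _] := (reads_charP _ _).1 rY.
have [g1 g2] := gZ n.
have hQ : S1 (Zs n) (fun (x : nat * nat) _ => x.1 <= x.2 /\ Y x.2).
  by apply: S1_and; [s1|apply: (S1_preimage Y1); deff].
have tot m : exists m', m <= m' /\ Y m'.
  by have [m' [hm hYm]] := infY m; exists m'; split=> //; apply: ltnW.
case: hY => hY.
  have [m [m' [[/= hm hYm] ho]]] := g1 _ hQ tot.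
  by apply: (ho m'); [rewrite hm leqnn|apply/(satS m' Y)/hY].
have [m [m' [[/= hm hYm] hi]]] := g2 _ (S2_S1 hQ) tot.
by apply: (hY m' hYm); apply/satS; apply: hi; rewrite hm leqnn.
Qed.

Theorem theorem7p1 :
  exists M : omega_model,
    models M (RCA0 `|` [set RT22]) /\ ~ models M Sigma02_Subset.
Proof.
have [O gO] := good_oracle; set S := (X in good X _) in gO.
have [Zs [rO mono gZ ram]] := ramsey_chain gO.
exists (chain_model Zs); split; last exact: (@chain_not_subset Zs O S).
by move=> p [hp|hp]; [apply: chain_RCA0|apply: (chain_RT22 mono ram)].
Qed.
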